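(* Fix a positive integer $\rho$ and a number $0<p<1$. (a) There is a constant $C=C(\rho,p)$ such that the following holds for every $\epsilon>0$ and all positive integers $r_1,\ldots,r_m\le\rho$ and $c_1,\ldots,c_n\le\rho$ with $r_1+\cdots+r_m=c_1+\cdots+c_n=N$. Let $A$ be the random $N\times N$ matrix obtained by splitting the rows into disjoint sets $R_1,\ldots,R_m$ with $|R_i|=r_i$, splitting the columns into disjoint sets $C_1,\ldots,C_n$ with $|C_j|=c_j$, and setting every entry in the block $R_i\times C_j$ equal to $\gamma_{ij}$, where the $\gamma_{ij}$ ($1\le i\le m$, $1\le j\le n$) are independent standard exponential random variables. Let $M=\lceil C\epsilon^{-2}\rceil$ and let $A_1,\ldots,A_M$ be independent copies of $A$. Then, with probability at least $p$, the quantity $$\frac{1}{r_1!\cdots r_m!\,c_1!\cdots c_n!}\cdot\frac1M\sum_{s=1}^M\operatorname{per}A_s$$ approximates the number of $m\times n$ contingency tables with row sums $r_1,\ldots,r_m$ and column sums $c_1,\ldots,c_n$ within relative error $\epsilon$. (b) Consequently, there is a randomized polynomial time approximation scheme for counting contingency tables whose row and column sums are bounded by $\rho$: for every $\epsilon>0$ there is a randomized algorithm, running in time polynomial in $N$, which, given positive integers $r_1,\ldots,r_m\le\rho$ and $c_1,\ldots,c_n\le\rho$ with common sum $N$, outputs with probability at least $p$ a number approximating the number of $m\times n$ contingency tables with these row and column sums within relative error $\epsilon$.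
   Context: An $m\times n$ contingency table with row sums $r_1,\ldots,r_m$ and column sums $c_1,\ldots,c_n$ is an $m\times n$ matrix with non-negative integer entries having these row and column sums. The permanent of an $N\times N$ matrix $A=(a_{ij})$ is $\operatorname{per}A=\sum_{\sigma\in S_N}\prod_{i=1}^N a_{i\sigma(i)}$. A random variable $\gamma$ is standard exponential if $\mathbf{P}(\gamma\ge t)=e^{-t}$ for $t\ge0$. A number $\tilde T$ approximates $T>0$ within relative error $\epsilon$ if $|\tilde T-T|\le\epsilon T$. Known result that may be used for (b) (Jerrum, Sinclair, Vigoda): there is a randomized polynomial time approximation scheme for computing the permanent of a given matrix with non-negative entries. *)

(* Defs.v *)
(* MathComp and MathComp-Analysis. *)
From HB Require Import structures.
From mathcomp Require Import all_boot all_order all_algebra all_fingroup.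
From mathcomp Require Import finmap.
From mathcomp Require Import all_classical all_reals all_analysis.

Set Implicit Arguments.
Unset Strict Implicit.
Unset Printing Implicit Defensive.

Import Order.TTheory GRing.Theory Num.Theory.

Local Open Scope classical_set_scope.
Local Open Scope ring_scope.

Definition ctables m n (r : 'I_m -> nat) (c : 'I_n -> nat) : set 'M[nat]_(m, n) :=
  [set D : 'M[nat]_(m, n) | (forall i, (\sum_j D i j)%N = r i) /\
                            (forall j, (\sum_i D i j)%N = c j)].

(* [fset_set] is only meaningful on finite sets. *)
Lemma finite_ctables m n (r : 'I_m -> nat) (c : 'I_n -> nat) :
  finite_set (ctables r c).
Proof.
pose B := (\sum_i r i)%N.
pose f (D : 'M['I_B.+1]_(m, n)) : 'M[nat]_(m, n) := \matrix_(i, j) (D i j : nat).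
apply: (@sub_finite_set _ _ (range f)); last exact/finite_image/finite_finset.
move=> D [rD _]; exists (\matrix_(i, j) inord (D i j)) => //.
apply/matrixP => i j; rewrite !mxE inordK // ltnS /B (bigD1 i) //= -rD.
by rewrite (bigD1 j) //= -addnA leq_addr.
Qed.

Definition num_ctables m n (r : 'I_m -> nat) (c : 'I_n -> nat) : nat :=
  #|` fset_set (ctables r c)|%fset.

Definition permanent (R : comNzRingType) N (A : 'M[R]_N) : R :=
  \sum_(s : 'S_N) \prod_i A i (s i).

Definition approximates (R : realType) (eps T Tt : R) : Prop :=
  `|Tt - T| <= eps * T.

Definition mutually_independent d (Omega : measurableType d) (R : realType)
    (P : probability Omega R) (I : finType) (X : I -> Omega -> R) : Prop :=
  forall (J : {set I}) (B : I -> set R), (forall k, measurable (B k)) ->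
    P (\bigcap_(k in [set` J]) (X k @^-1` B k)) =
    (\prod_(k in J) P (X k @^-1` B k))%E.

Definition standard_exponential d (Omega : measurableType d) (R : realType)
    (P : probability Omega R) (X : Omega -> R) : Prop :=
  forall t : R, 0 <= t -> P [set w | t <= X w] = (expR (- t))%:E.

(* A splitting of 'I_N into labelled disjoint sets S_0, ..., S_(m-1) of
   prescribed sizes is given by the map sending each k to the label of the set
   containing it. *)
Definition splitting N m (s : 'I_m -> nat) (b : 'I_N -> 'I_m) : Prop :=
  forall i, #|[set k | b k == i]%SET| = s i.

Definition block_mx_of (R : realType) N m n (rb : 'I_N -> 'I_m)
    (cb : 'I_N -> 'I_n) (g : 'I_m -> 'I_n -> R) : 'M[R]_N :=
  \matrix_(k, l) g (rb k) (cb l).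

Definition permanent_mean (R : realType) m n (r : 'I_m -> nat)
    (c : 'I_n -> nat) N M (A : 'I_M -> 'M[R]_N) : R :=
  ((\prod_i (r i)`!) * (\prod_j (c j)`!))%N%:R^-1 *
  (M%:R^-1 * \sum_s permanent (A s)).

(* Randomized algorithms are probabilistic random access machines: structured
   programs over registers and arrays of natural numbers, with indirect
   addressing and fair coin tosses, at unit cost per step. The only arithmetic
   is addition and truncated subtraction, so the bit length of the numbers
   grows by at most one per step and unit-cost time is polynomially related to
   Turing machine time. *)
Inductive cmd : Type :=
| Skip
| Const (x k : nat)    (* x := k *)
| Add (x y z : nat)    (* x := y + z *)
| Sub (x y z : nat)    (* x := y - z, truncated at 0 *)
| Get (x a y : nat)    (* x := a[y] *)
| Put (a x y : nat)    (* a[x] := y *)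
| Flip (x : nat)       (* x := a fair random bit *)
| Seq (p q : cmd)
| If (x : nat) (p q : cmd)  (* p if x is nonzero, else q *)
| While (x : nat) (p : cmd). (* iterate p as long as x is nonzero *)

(* [todo] is the stack of commands still to be executed; [coins] lists the
   outcomes of the coin tosses to come. *)
Record config : Type := Config {
  todo : seq cmd;
  reg : nat -> nat;
  arr : nat -> nat -> nat;
  coins : seq bool }.

Definition upd (V : Type) (f : nat -> V) (x : nat) (v : V) : nat -> V :=
  fun y => if y == x then v else f y.

Definition step (s : config) : config :=
  let: Config t v h w := s in
  if t is p :: t' then
    match p with
    | Skip => Config t' v h w
    | Const x k => Config t' (upd v x k) h w
    | Add x y z => Config t' (upd v x (v y + v z)%N) h w
    | Sub x y z => Config t' (upd v x (v y - v z)%N) h w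
    | Get x a y => Config t' (upd v x (h a (v y))) h w
    | Put a x y => Config t' v (upd h a (upd (h a) (v x) (v y))) w
    | Flip x => Config t' (upd v x (head false w : nat)) h (behead w)
    | Seq p1 p2 => Config (p1 :: p2 :: t') v h w
    | If x p1 p2 => Config ((if v x == 0%N then p2 else p1) :: t') v h w
    | While x p1 =>
        Config (if v x == 0%N then t' else p1 :: While x p1 :: t') v h w
    end
  else s.

Definition halted (s : config) : bool := nilp (todo s).

(* Input: m and n in registers 0 and 1, the row sums in array 0, the column
   sums in array 1, and 0 everywhere else. *)
Definition initial (p : cmd) m n (r : 'I_m -> nat) (c : 'I_n -> nat)
    (w : seq bool) : config :=
  Config [:: p]
    (upd (upd (fun=> 0%N) 1 n) 0 m)
    (upd (upd (fun=> fun=> 0%N) 1 (fun k => oapp c 0%N (insub k)))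
      0 (fun k => oapp r 0%N (insub k)))
    w.

(* Output: the rational number with numerator in register 0 and denominator in
   register 1. *)
Definition output (R : realType) (s : config) : R :=
  (reg s 0%N)%:R / (reg s 1%N)%:R.

(* At most t coins are tossed in t steps, so t coins suffice. *)
Definition halts_within (p : cmd) m n (r : 'I_m -> nat) (c : 'I_n -> nat)
    (t : nat) : Prop :=
  forall w : t.-tuple bool, halted (iter t step (initial p r c w)).

(* Probability, over t fair coin tosses, that the output after t steps is in
   the set G. *)
Definition output_prob (R : realType) (p : cmd) m n (r : 'I_m -> nat)
    (c : 'I_n -> nat) (t : nat) (G : set R) : R :=
  #|[set w : t.-tuple bool |
      output R (iter t step (initial p r c w)) \in G]%SET|%:R / 2 ^+ t.

(* Main.v *)
(** (a) For a permutation [s] let [D(s)] be the table whose entry at [(i, j)]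
    counts the units of row block [i] sent to column block [j]. Then
    [E per A] is the sum over [s] of the products of the [D(s)_ij!]. Each table
    [D] occurs for [prod r_i! prod c_j! / prod D_ij!] permutations, so
    [E per A = T prod r_i! prod c_j! >= N!], where [T] is the number of tables.
    The second moment is the sum over pairs [(s, t)] of the products of the
    [(D(s) + D(t))_ij!]. For fixed [t] the quotient by [prod D(t)_ij!] factors
    over the units of [s], and the units of a given rank inside their row block
    can be permuted among themselves, the others being frozen: each such factor
    is then a permanent of an all-one matrix perturbed by rows of bounded sum,
    so its mean is bounded in terms of [rho] only. Hence the relative variance
    of [per A] is bounded in terms of [rho], and Chebyshev's inequality applies.

    (b) The number [T(r, c)] depends on [c] only through the multiplicities of
    the values [1, ..., rho], so there are at most [(n + 1) ^ rho] states, and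
    [r_i T(r, c)] is the sum of [T(r - k e_i, c - k e_j)] over [1 <= k <= r_i]
    and [j]. This gives an exact dynamic programming algorithm, which tosses no
    coins and makes no use of the permanent. *)

Require Import Defs.
From HB Require Import structures.
From mathcomp Require Import all_boot all_order all_algebra all_fingroup.
From mathcomp Require Import finmap.
From mathcomp Require Import all_classical all_reals all_analysis.
From mathcomp Require Import measurable_realfun ring zify.

Set Implicit Arguments.
Unset Strict Implicit.
Unset Printing Implicit Defensive.

Import Order.TTheory GRing.Theory Num.Theory.
Import numFieldNormedType.Exports.

Local Open Scope classical_set_scope.
Local Open Scope ring_scope.


(** * Permutations and contingency tables *)

(** Factors attached to different ranks are dependent, so their means cannot be multiplied. As there
    are at most [rho] ranks, the product over ranks is bounded by the sum of the [rho]-th powers,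
    and each power is averaged alone; this costs only the factor [rho] in
    [kappa = rho * expR (overlap_const rho)], and Chebyshev's inequality then asks for
    [C = kappa / (1 - p)]. The bound [E per A >= N!] absorbs the [N!] produced by summing over
    permutations. The sum of the [M] permanents is treated as one polynomial in a single independent
    family indexed by copy, row and column, so that independence of the copies becomes disjointness
    of monomials. In (b) the obstacle is the division by [r_i] in the recurrence, on a machine that
    only adds and subtracts: the dynamic program stores counts multiplied by factorials, and the
    division is left to the output fraction, whose denominator is [prod r_i!]. *)

Lemma lift_perm_exists n (i0 : 'I_n.+1) (s : 'S_n.+1) :
  exists t : 'S_n, s = lift_perm i0 (s i0) t.
Proof.
pose u (k : 'I_n) := odflt k (unlift (s i0) (s (lift i0 k))).
have uK k : lift (s i0) (u k) = s (lift i0 k).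
  rewrite /u; have := neq_lift i0 k.
  by rewrite -(can_eq (permK s)) => /unlift_some[] ? ? ->.
have inj_u : injective u.
  by move=> k l ukl; apply: (@lift_inj _ i0); apply: (@perm_inj _ s); rewrite -!uK ukl.
exists (perm inj_u); apply/permP => k.
case: (unliftP i0 k) => [k'|] ->; last by rewrite lift_perm_id.
by rewrite lift_perm_lift permE uK.
Qed.

Lemma lift_perm_inj n (i j : 'I_n.+1) : injective (@lift_perm n i j).
Proof.
move=> s t /permP st; apply/permP => k.
by apply: (@lift_inj _ j); rewrite -!(lift_perm_lift i) st.
Qed.

Lemma card_preim_lift n (L : finType) (f : 'I_n.+1 -> L) k0 x :
  #|[set k | f k == x]%SET| =
  ((f k0 == x) + #|[set k | f (lift k0 k) == x]%SET|)%N.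
Proof.
rewrite -!sum1_card !(big_mkcond (fun k => k \in _)) /=.
rewrite (bigD1_ord k0) //= inE.
congr (_ + _)%N.
by apply: eq_bigr => k _; rewrite !inE.
Qed.

(** Induction on [n]: the point 0 may go to any [l] with [g l = f 0], and deleting 0 from the source
    and [l] from the target leaves two labellings with equal fibre sizes. The permutations sending 0
    to [l] are the [lift_perm] of those of the remaining points. *)
Lemma card_perm_relabel n (L : finType) (f g : 'I_n -> L) :
  (forall x, #|[set k | f k == x]%SET| = #|[set k | g k == x]%SET|) ->
  #|[set s : 'S_n | [forall k, g (s k) == f k]]%SET| =
  (\prod_x #|[set k | f k == x]%SET| `!)%N.
Proof.
elim: n f g => [|n IHn] f g fg.
  rewrite big1 => [|x _]; last first.
    by rewrite (_ : finset _ = finset.set0) ?cards0 //; apply/setP => -[].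
  rewrite (_ : finset _ = [set: 'S_0]%SET) ?cardsT ?card_Sn //.
  by apply/setP => s; rewrite !inE; apply/forallP => -[].
pose k0 : 'I_n.+1 := ord0; pose x0 := f k0.
pose h := (\prod_x #|[set k | f (lift k0 k) == x]%SET| `!)%N.
have hE : (\prod_x #|[set k | f k == x]%SET| `! =
           #|[set k | f k == x0]%SET| * h)%N.
  rewrite /h (bigD1 x0) //= [in RHS](bigD1 x0) //= mulnA.
  rewrite (card_preim_lift _ k0) eqxx add1n factS; congr (_ * _)%N.
  apply: eq_bigr => x xx0; rewrite (card_preim_lift _ k0).
  by rewrite [f k0 == x]eq_sym (negPf xx0).
rewrite hE fg -sum1_card.
rewrite (partition_big (fun s : 'S_n.+1 => s k0)
  (fun l => l \in [set l | g l == x0]%SET)) /=; last first.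
  by move=> s; rewrite !inE => /forallP /(_ k0).
transitivity (\sum_(l in [set l | g l == x0]%SET) h)%N; last by rewrite sum_nat_const.
apply: eq_bigr => l.
rewrite inE => /eqP gl.
rewrite /h -(IHn (fun k => f (lift k0 k)) (fun k => g (lift l k))); last first.
  move=> x; have := fg x; rewrite (card_preim_lift f k0) (card_preim_lift g l).
  by rewrite gl -/x0 => /addnI.
rewrite sum1_card -(card_imset _ (@lift_perm_inj n k0 l)).
apply: eq_card => s; rewrite [LHS]unfold_in /= inE; apply/andP/imsetP.
  case=> /forallP sP /eqP sl; have [t st] := lift_perm_exists k0 s.
  exists t; last by rewrite st sl.
  rewrite inE; apply/forallP => k; rewrite -(lift_perm_lift k0) -sl -st; exact: sP.
case=> t; rewrite inE => /forallP tP ->; rewrite lift_perm_id eqxx; split=> //.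
apply/forallP => k; case: (unliftP k0 k) => [k'|] ->.
  by rewrite lift_perm_lift tP.
by rewrite lift_perm_id gl.
Qed.

Lemma labelling_exists N (L : finType) (a : L -> nat) : (\sum_x a x)%N = N ->
  exists h : 'I_N -> L, forall x, #|[set k | h k == x]%SET| = a x.
Proof.
move=> aN; pose s := flatten [seq nseq (a x) x | x <- enum L].
have ss : size s == N.
  rewrite size_flatten /shape -map_comp sumnE big_map big_enum /= -aN.
  by apply/eqP; apply: eq_bigr => x _; rewrite /= size_nseq.
exists (tnth (Tuple ss)) => x.
have -> : a x = count_mem x (Tuple ss).
  rewrite /= count_flatten -map_comp sumnE big_map big_enum /= (bigD1 x) //=.
  rewrite count_nseq /= eqxx mul1n big1 ?addn0 // => y yx.
  by rewrite /= count_nseq /= (negPf yx) mul0n.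
rewrite cardE -size_filter -(map_tnth_enum (Tuple ss)) filter_map size_map.
rewrite enumT {1}/enum_mem.
congr size; apply: eq_filter => k.
exact: finset.in_set.
Qed.

Definition contingency m n N (rb : 'I_N -> 'I_m) (cb : 'I_N -> 'I_n)
    (s : 'S_N) : 'M[nat]_(m, n) :=
  \matrix_(i, j) #|[set k | (rb k == i) && (cb (s k) == j)]%SET|.

Lemma card_preim_perm N (L : finType) (f : 'I_N -> L) (s : 'S_N) x :
  #|[set k | f (s k) == x]%SET| = #|[set k | f k == x]%SET|.
Proof.
rewrite -!sum1_card [RHS](reindex_inj (@perm_inj _ s)) /=.
by apply: eq_bigl => k; rewrite !inE.
Qed.

Lemma card_preim_fst N m n (h : 'I_N -> 'I_m * 'I_n) i :
  #|[set k | (h k).1 == i]%SET| = (\sum_j #|[set k | h k == (i, j)]%SET|)%N.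
Proof.
rewrite -sum1_card (partition_big (fun k => (h k).2) predT) //=.
apply: eq_bigr => j _; rewrite -sum1_card; apply: eq_bigl => k.
by rewrite !inE; case: (h k).
Qed.

Lemma card_preim_snd N m n (h : 'I_N -> 'I_m * 'I_n) j :
  #|[set k | (h k).2 == j]%SET| = (\sum_i #|[set k | h k == (i, j)]%SET|)%N.
Proof.
rewrite -sum1_card (partition_big (fun k => (h k).1) predT) //=.
apply: eq_bigr => i _; rewrite -sum1_card; apply: eq_bigl => k.
by rewrite !inE; case: (h k) => ? ?; rewrite [RHS]andbC.
Qed.

Section Contingency.
Variables (m n N : nat) (r : 'I_m -> nat) (c : 'I_n -> nat).
Variables (rb : 'I_N -> 'I_m) (cb : 'I_N -> 'I_n).
Hypotheses (rbP : splitting r rb) (cbP : splitting c cb).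

Lemma contingency_ctables s : ctables r c (contingency rb cb s).
Proof.
split=> [i | j].
  rewrite -rbP (card_preim_fst (fun k => (rb k, cb (s k)))).
  by apply: eq_bigr => j _; rewrite mxE.
rewrite -cbP -(card_preim_perm cb s).
rewrite (card_preim_snd (fun k => (rb k, cb (s k)))).
by apply: eq_bigr => i _; rewrite mxE.
Qed.

(* Fix a labelling [h] of the units by the cells of [D]. The right-hand side
   counts the pairs of permutations [(a, b)] carrying the row and column labels
   to those of [h]; sending such a pair to [a * b^-1] gives a permutation with
   contingency table [D], and [h \o a] is then determined, whence a fibre of size
   [\prod_i \prod_j (D i j)`!]. *)
Lemma card_contingency (D : 'M[nat]_(m, n)) : ctables r c D ->
  (#|[set s | contingency rb cb s == D]%SET| * \prod_i \prod_j (D i j)`! =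
   (\prod_i (r i)`!) * (\prod_j (c j)`!))%N.
Proof.
move=> [rD cD].
have rN : (\sum_i r i)%N = N.
  under eq_bigr do rewrite -rbP -sum1_card.
  rewrite -[RHS]card_ord -sum1_card [RHS](partition_big rb predT) //=.
  by apply: eq_bigr => i _; apply: eq_bigl => k; rewrite inE.
have [|h hP] := @labelling_exists N ('I_m * 'I_n)%type (fun ij => D ij.1 ij.2).
  by rewrite -(pair_bigA _ (fun i j => D i j)) -[RHS]rN; apply: eq_bigr => i _.
pose Q (s a : 'S_N) := [forall k, h (a k) == (rb k, cb (s k))].
have QD s a : Q s a -> contingency rb cb s = D.
  move=> /forallP sa; apply/matrixP => i j; rewrite mxE -(hP (i, j)).
  rewrite -(card_preim_perm h a); apply: eq_card => k.
  by rewrite !inE (eqP (sa k)).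
rewrite -sum_nat_const.
transitivity (\sum_(s : 'S_N) \sum_(a : 'S_N | Q s a) 1)%N.
  rewrite [RHS](bigID (fun s => contingency rb cb s == D)) /=.
  rewrite [X in (_ + X)%N]big1 ?addn0; last first.
    by move=> s /eqP sD; rewrite big1 // => a /QD.
  apply: eq_big => [s | s]; rewrite inE // => /eqP sD.
  rewrite (pair_bigA _ (fun i j => (D i j)`!)) /=.
  transitivity (\prod_(x : 'I_m * 'I_n) #|[set k | (rb k, cb (s k)) == x]%SET| `!)%N.
    by apply: eq_bigr => -[i j] _; rewrite -sD mxE.
  rewrite -(@card_perm_relabel _ _ _ h) ?sum1dep_card //; last first.
    by move=> [i j]; rewrite hP -sD mxE.
rewrite (exchange_big_dep predT) //=.
transitivity (\sum_(a in [set a : 'S_N | [forall k, (h (a k)).1 == rb k]]%SET)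
   \prod_j (c j)`!)%N; last first.
  rewrite sum_nat_const (@card_perm_relabel _ _ rb (fun k => (h k).1)); last first.
    by move=> i; rewrite rbP card_preim_fst -rD; apply: eq_bigr => j _; rewrite hP.
  by congr (_ * _)%N; apply: eq_bigr => i _; rewrite rbP.
rewrite [RHS]big_mkcond; apply: eq_bigr => a _.
rewrite inE; case: ifP => [/forallP ha | /negP ha]; last first.
  rewrite big1 // => s /forallP sa; case: ha; apply/forallP => k.
  by rewrite (eqP (sa k)).
transitivity (\prod_j #|[set k | (h (a k)).2 == j]%SET| `!)%N; last first.
  apply: eq_bigr => j _; congr _`!.
  rewrite (card_preim_perm (fun k => (h k).2) a) card_preim_snd -cD.
  by apply: eq_bigr => i _; rewrite hP.
rewrite -(@card_perm_relabel _ _ _ cb) => [|j]; last first.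
  rewrite cbP (card_preim_perm (fun k => (h k).2) a) card_preim_snd -cD.
  by apply: eq_bigr => i _; rewrite hP.
rewrite sum1dep_card; apply: eq_card => s; rewrite !inE.
apply: eq_forallb => k; rewrite -pair_eqE /= (ha k) andTb.
by rewrite eq_sym.
Qed.

(** Since the [d]-th moment of a standard exponential variable is [d!], the left-hand side is the
    mean of [per A]: the estimator is unbiased. *)
Lemma sum_contingency_fact :
  (\sum_s \prod_i \prod_j (contingency rb cb s i j)`! =
   num_ctables r c * ((\prod_i (r i)`!) * (\prod_j (c j)`!)))%N.
Proof.
have finC := finite_ctables r c.
rewrite /num_ctables.
rewrite cardfE -sum1_card big_distrl /=.
transitivity (\sum_(D : fset_set (ctables r c)) \sum_(s | contingency rb cb s == val D)
   \prod_i \prod_j (val D i j)`!)%N; last first.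
  apply: eq_bigr => D _; rewrite mul1n sum_nat_const -(@card_contingency (val D)).
    by congr (_ * _)%N; apply: eq_card => s; rewrite inE.
  by have := valP D; rewrite in_fset_set // inE.
rewrite (exchange_big_dep predT) //=; apply: eq_bigr => s _.
have sC : contingency rb cb s \in fset_set (ctables r c).
  by rewrite in_fset_set // inE; exact: contingency_ctables.
by rewrite (big_pred1 [` sC]%fset).
Qed.

Lemma fact_le_sum_contingency :
  (N`! <= num_ctables r c * ((\prod_i (r i)`!) * (\prod_j (c j)`!)))%N.
Proof.
rewrite -sum_contingency_fact -[in leqLHS]card_Sn -cardsT -sum1_card.
rewrite (eq_bigl predT) => [|s]; last by rewrite inE.
by apply: leq_sum => s _; do 2![apply: prodn_gt0 => ?]; exact: fact_gt0.
Qed.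
End Contingency.

(** * Second moment over pairs of permutations *)

(** Composing with the inverse of one such permutation [p0] gives permutations that fix [S]
    pointwise, hence are supported on [A :\: S]. *)
Lemma card_perm_on_eq_in (T : finType) (A S : {set T}) (f : T -> T) :
  S \subset A ->
  (#|[set p : {perm T} | perm_on A p && [forall k in S, p k == f k]]%SET|
   <= (#|A| - #|S|)`!)%N.
Proof.
move=> SA; set X := finset _.
have [->|[p0]] := set_0Vmem X; first by rewrite cards0.
rewrite inE => /andP[p0A /forall_inP p0f].
have -> : (#|A| - #|S|)%N = #|A :\: S|%SET by rewrite cardsD (finset.setIidPr SA).
rewrite -card_perm -(card_imset _ (mulIg p0^-1%g)).
apply: subset_leq_card; apply/fintype.subsetP => _ /imsetP[p pX ->].
move: pX; rewrite inE => /andP[pA /forall_inP pf]; rewrite unfold_in.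
apply/fintype.subsetP => k; rewrite inE /= permM => kp; rewrite inE; apply/andP; split.
  by apply: contra kp => kS; rewrite (eqP (pf k kS)) -(eqP (p0f k kS)) permK.
apply: contraR kp => kA; rewrite (out_perm pA kA) -[X in _ == X](permK p0).
by rewrite (out_perm p0A kA).
Qed.

(** Permutations are grouped by their restriction to [S], shared by at most [(#|A| - #|S|)!] of
    them. Once injectivity is dropped, the sum over all maps from [S] to [A] factors into row
    sums. *)
Lemma sum_perm_on_prod_le (T : finType) (A S : {set T}) (x : T -> T -> nat) C :
  S \subset A -> (forall k, k \in A -> (\sum_(l in A) x k l <= C)%N) ->
  (\sum_(p : {perm T} | perm_on A p) \prod_(k in S) x k (p k) <=
   C ^ #|S| * (#|A| - #|S|)`!)%N.
Proof.
move=> SA xC.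
(* Maps from [S] to [A] are represented by total functions that are the identity outside [S]. *)
pose Q k := [pred l | if k \in S then l \in A else l == k].
pose h (p : {perm T}) := [ffun k => if k \in S then p k else k].
rewrite (partition_big h (fun f => f \in family Q)) /=; last first.
  move=> p pA; apply/familyP => k; rewrite ffunE inE.
  by case: (boolP (k \in S)) => //= kS; rewrite perm_closed // (fintype.subsetP SA).
apply: (@leq_trans (\sum_(f in family Q) (#|A| - #|S|)`! *
    \prod_k (if k \in S then x k (f k) else 1%N))%N).
  apply: leq_sum => f fQ; rewrite -big_mkcond /=.
  apply: (@leq_trans (\sum_(p in [set p : {perm T} |
      perm_on A p && [forall k in S, p k == f k]]%SET) \prod_(k in S) x k (f k))%N).
    rewrite [X in (X <= _)%N]big_mkcond [X in (_ <= X)%N]big_mkcond.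
    apply: leq_sum => p _; rewrite inE; case: ifP => // /andP[pA /eqP hp].
    rewrite pA; case: ifP => [_|/negP[]].
      apply/eq_leq/eq_bigr => k kS; by rewrite -hp ffunE kS.
    by apply/forall_inP => k kS; rewrite -hp ffunE kS.
  by rewrite sum_nat_const leq_mul2r card_perm_on_eq_in ?orbT.
rewrite -big_distrr /= mulnC leq_mul2r; apply/orP; right.
rewrite -(bigA_distr_big_dep Q (fun k l => if k \in S then x k l else 1%N)).
rewrite -prod_nat_const [X in (_ <= X)%N]big_mkcond.
apply: leq_prod => k _; rewrite /Q; case: ifP => kS /=.
  by apply: xC; apply: (fintype.subsetP SA).
by rewrite big_pred1_eq.
Qed.

Lemma sum_perm_on_prod1D_le (T : finType) (A : {set T}) (x : T -> T -> nat) C :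
  (forall k, k \in A -> (\sum_(l in A) x k l <= C)%N) ->
  (\sum_(p : {perm T} | perm_on A p) \prod_(k in A) (1 + x k (p k)) <=
   \sum_(s < #|A|.+1) 'C(#|A|, s) * (C ^ s * (#|A| - s)`!))%N.
Proof.
move=> xC.
have E (p : {perm T}) : (\prod_(k in A) (1 + x k (p k)) =
    \sum_(S : {set T} | S \subset A) \prod_(k in S) x k (p k))%N.
  rewrite (eq_bigr (fun k => x k (p k) + 1)%N); last by move=> k _; rewrite addnC.
  rewrite big_mkcond (eq_bigr (fun k => (if k \in A then x k (p k) else 0) + 1)%N);
    last by move=> k _; case: ifP.
  rewrite bigA_distr [RHS]big_mkcond; apply: eq_bigr => S _.
  case: ifP => SA.
    rewrite [RHS]big_mkcond; apply: eq_bigr => k _; case: ifP => // kS.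
    by rewrite (fintype.subsetP SA).
  have /fintype.subsetPn[k kS kA] := negbT SA.
  by rewrite (bigD1 k) //= kS (negPf kA) mul0n.
under eq_bigr do rewrite E.
rewrite (exchange_big_dep (fun S : {set T} => S \subset A)) //=.
apply: (@leq_trans (\sum_(S : {set T} | S \subset A)
    C ^ #|S| * (#|A| - #|S|)`!)%N).
  apply: leq_sum => S SA; rewrite (eq_bigl (perm_on A)) => [|p]; last by rewrite SA andbT.
  exact: sum_perm_on_prod_le.
rewrite (partition_big (fun S : {set T} => inord #|S| : 'I_#|A|.+1) predT) //=.
apply: leq_sum => s _.
rewrite (eq_bigr (fun _ => C ^ s * (#|A| - s)`!)%N); last first.
  move=> S /andP[SA /eqP <-]; rewrite inordK // ltnS; exact: subset_leq_card.
rewrite sum_nat_const leq_mul2r; apply/orP; right.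
rewrite -(cards_draws A s); apply: subset_leq_card; apply/fintype.subsetP => S.
rewrite unfold_in inE => /andP[SA /eqP <-]; rewrite SA inordK //= ltnS.
exact: subset_leq_card.
Qed.

Lemma sum_exp_coeff_le (R : realType) (x : R) n : 0 <= x ->
  \sum_(s < n) x ^+ s / s`!%:R <= expR x.
Proof.
move=> x0; rewrite /expR.
have nd : nondecreasing_seq (series (exp_coeff x)).
  apply/nondecreasing_seqP => k; rewrite /series /= big_nat_recr //= lerDl.
  exact: exp_coeff_ge0.
have := nondecreasing_cvgn_le nd (is_cvg_series_exp_coeff x) n.
by rewrite /series /= big_mkord.
Qed.

(** With [a = #|A|], the binomial coefficient times [(a - s)!] is [a! / s!], so the previous bound
    is [a!] times a partial sum of the exponential series: the mean over the permutations of [A] is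
    bounded independently of [a]. *)
Lemma sum_perm_on_prod1D_expR (R : realType) (T : finType) (A : {set T})
    (x : T -> T -> nat) C :
  (forall k, k \in A -> (\sum_(l in A) x k l <= C)%N) ->
  (\sum_(p : {perm T} | perm_on A p) \prod_(k in A) (1 + x k (p k)))%N%:R <=
   #|A| `!%:R * expR C%:R :> R.
Proof.
move=> /sum_perm_on_prod1D_le; rewrite -(ler_nat R) => /le_trans; apply.
apply: (@le_trans _ _ (#|A| `!%:R * \sum_(s < #|A|.+1) C%:R ^+ s / s`!%:R)).
  rewrite natr_sum big_distrr /=; apply: ler_sum => s _.
  have sA : (s <= #|A|)%N by rewrite -ltnS.
  rewrite -(bin_fact sA) !natrM natrX le_eqVlt; apply/orP; left; apply/eqP.
  by field; rewrite pnatr_eq0 -lt0n fact_gt0.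
by rewrite ler_wpM2l // sum_exp_coeff_le.
Qed.

(** Left multiplication by a fixed [p] permutes the whole group, so an extra average over the
    permutations of [A] can be inserted. *)
Lemma sum_perm_average (T : finType) (A : {set T}) (W : {perm T} -> nat) :
  (#|A| `! * \sum_s W s =
   \sum_s \sum_(p : {perm T} | perm_on A p) W (p * s)%g)%N.
Proof.
rewrite (exchange_big_dep (perm_on A)) //= -card_perm -sum_nat_const.
apply: eq_bigr => p pA; rewrite (reindex_inj (mulgI p)) /=.
by have -> : perm_on A p by [].
Qed.

(** In increasing order, the elements of [S] contribute [e + 1, ..., e + #|S|]. The induction
    removes the largest element, which leaves the ranks of the others unchanged. *)
Lemma fact_prod_rank N (S : {set 'I_N}) e :
  (e`! * \prod_(k in S) (1 + e + #|[set l in S | (l < k)%N]%SET|) =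
   (e + #|S|)`!)%N.
Proof.
move: {2}#|S| (erefl #|S|) => d; elim: d S => [|d IHd] S cS.
  by rewrite cS addn0 (cards0_eq cS) big_set0 muln1.
have [k0 k0S] : exists k, k \in S by apply/card_gt0P; rewrite cS.
case: (@arg_maxnP _ k0 (fun k => k \in S) (fun k : 'I_N => k : nat) k0S) => k kS kmax.
have cSk : #|S :\ k| = d by have := cardsD1 k S; rewrite kS cS => -[].
rewrite (bigD1 k) //= mulnCA (eq_bigl (fun l => l \in S :\ k)%SET); last first.
  by move=> l; rewrite in_setD1 andbC.
rewrite (eq_bigr (fun l : 'I_N => 1 + e + #|[set l' in (S :\ k)%SET | (l' < l)%N]%SET|)%N).
  rewrite IHd // cSk cS addnS factS; congr (_ * _)%N.
  rewrite add1n addSn; congr (_ + _).+1.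
  rewrite -cSk; apply: eq_card => l; rewrite !inE andbC.
  case lS: (l \in S); rewrite ?andbF // !andbT.
  by have := kmax _ lS; rewrite /geq ltn_neqAle -val_eqE /= => ->; rewrite andbT.
move=> l; rewrite in_setD1 => /andP[lk lS]; congr (_ + _)%N.
apply: eq_card => l'; rewrite !inE.
have [->|//] := eqVneq l' k; rewrite /=.
by rewrite (ltnNge k l) (kmax _ lS : (l <= k)%N) andbF.
Qed.

(** The largest factor, raised to the power [d], bounds the product. This stands in for Hölder's
    inequality when the ranks are decoupled. *)
Lemma prod_le_sum_expn d (x : 'I_d -> nat) : (0 < d)%N ->
  (\prod_a x a <= \sum_a x a ^ d)%N.
Proof.
move=> d0; case: (@arg_maxnP _ (Ordinal d0) predT x erefl) => a _ amax.
rewrite [leqRHS](bigD1 a) //=; apply: leq_trans (leq_addr _ _).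
have <- : (\prod_(i < d) x a = x a ^ d)%N by rewrite prod_nat_const card_ord.
by apply: leq_prod => i _; exact: amax.
Qed.

Section SecondMoment.
Variables (m n N rho : nat) (r : 'I_m -> nat) (c : 'I_n -> nat).
Variables (rb : 'I_N -> 'I_m) (cb : 'I_N -> 'I_n).
Hypotheses (rho_gt0 : (0 < rho)%N) (rbP : splitting r rb) (cbP : splitting c cb).
Hypotheses (r_le : forall i, (r i <= rho)%N) (c_le : forall j, (c j <= rho)%N).
Variable E : 'I_m -> 'I_n -> nat.
Hypothesis rowE : forall i, (\sum_j E i j <= rho)%N.

Definition before (k : 'I_N) := [set l : 'I_N | (rb l == rb k) && (l < k)%N]%SET.

Lemma card_before k : (#|before k| < rho)%N.
Proof.
apply: leq_trans (r_le (rb k)); rewrite -rbP; apply: proper_card.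
apply/properP; split.
  by apply/fintype.subsetP => l; rewrite !inE => /andP[].
by exists k; rewrite !inE ?eqxx ?ltnn ?andbF.
Qed.

Lemma card_before_lt k l : l \in before k -> (#|before l| < #|before k|)%N.
Proof.
rewrite inE => /andP[/eqP rlk lk]; apply: proper_card; apply/properP; split.
  apply/fintype.subsetP => l'; rewrite !inE rlk => /andP[-> l'l].
  exact: ltn_trans lk.
by exists l; rewrite !inE ?rlk ?eqxx ?ltnn ?andbF.
Qed.

(** What unit [k] finds in column [j] of its row when the units are inserted in increasing order on
    top of the table [E]. *)
Definition occupancy (s : 'S_N) k j :=
  (E (rb k) j + #|[set l in before k | cb (s l) == j]%SET|)%N.

(** In each cell, [(D + E)! / E!] is the product of the successive sizes reached as the units of
    that cell are inserted one by one. *)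
Lemma contingency_occupancy s :
  (\prod_i \prod_j (contingency rb cb s i j + E i j)`! =
   (\prod_i \prod_j (E i j)`!) * \prod_k (1 + occupancy s k (cb (s k))))%N.
Proof.
rewrite (partition_big rb predT) //= -big_split; apply: eq_bigr => i _ /=.
rewrite (partition_big (fun k => cb (s k)) predT) //= -big_split.
apply: eq_bigr => j _ /=; rewrite mxE addnC -fact_prod_rank; congr (_ * _)%N.
apply: eq_big => [k|k]; rewrite inE // => /andP[/eqP rk /eqP ck].
rewrite /occupancy rk ck addnA; congr (_ + _)%N; apply: eq_card => l.
by rewrite !inE rk andbAC.
Qed.

(** For [u <= 2 * rho], [(1 + u) ^ rho - 1 <= (1 + 2 * rho) ^ rho * u]; and the occupancies of a
    unit, summed over its possible images, amount to at most [2 * rho ^ 2]. The constant multiplies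
    the two bounds. *)
Definition overlap_const := ((1 + 2 * rho) ^ rho * (2 * rho ^ 2))%N.

(** The table [E] and the earlier units each put at most [rho] items in the row of [k], and each
    item is counted once for every unit [l] sent to its column, hence at most [rho] times. *)
Lemma sum_occupancy s k : (\sum_l occupancy s k (cb (s l)) <= 2 * rho ^ 2)%N.
Proof.
have cbs (j : 'I_n) : (\sum_(l | cb (s l) == j) 1 <= rho)%N.
  rewrite (reindex_inj (@perm_inj _ s^-1%g)) /=.
  rewrite (eq_bigl (fun l => cb l == j)); last by move=> l; rewrite permKV.
  apply: leq_trans (c_le j); rewrite -cbP -sum1_card; apply: eq_leq.
  by apply: eq_bigl => l; rewrite inE.
rewrite big_split mul2n -addnn leq_add //.
  rewrite (partition_big (fun l => cb (s l)) predT) //=.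
  apply: (@leq_trans (\sum_j E (rb k) j * rho)%N).
    apply: leq_sum => j _; rewrite (eq_bigr (fun _ => E (rb k) j * 1)%N); last first.
      by move=> l /eqP ->; rewrite muln1.
    by rewrite -big_distrr leq_mul2l cbs orbT.
  by rewrite -big_distrl /= -mulnn leq_mul2r rowE orbT.
under eq_bigr do rewrite -sum1_card.
rewrite (exchange_big_dep (fun l => l \in before k)) /=; last first.
  by move=> l l' _; rewrite inE => /andP[].
apply: (@leq_trans (\sum_(l in before k) rho)%N).
  apply: leq_sum => l lk; apply: leq_trans (cbs (cb (s l))).
  by apply: eq_leq; apply: eq_bigl => l'; rewrite inE lk eq_sym.
by rewrite sum_nat_const -mulnn leq_mul2r (ltnW (card_before k)) orbT.
Qed.

Lemma occupancy_le s k j : (occupancy s k j <= 2 * rho)%N.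
Proof.
rewrite mul2n -addnn leq_add //.
  by apply: leq_trans (rowE (rb k)); rewrite (bigD1 j) //= leq_addr.
apply: leq_trans (ltnW (card_before k)); apply: subset_leq_card.
by apply/fintype.subsetP => l; rewrite inE => /andP[].
Qed.

Definition unit_rank a := [set k | #|before k| == a]%SET.

(* Units of equal rank lie in distinct rows, so permuting them among themselves
   does not change what precedes any of them in its row. *)
Lemma occupancy_perm_on a s (p : 'S_N) k j : k \in unit_rank a ->
  perm_on (unit_rank a) p -> occupancy (p * s)%g k j = occupancy s k j.
Proof.
rewrite inE => /eqP ka pA; congr (_ + _)%N; apply: eq_card => l; rewrite !inE.
case: (boolP (l \in before k)) => [lk|]; last by rewrite inE => /negPf ->.
have := lk; rewrite inE => -> /=; rewrite permM (out_perm pA) // inE.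
by have := card_before_lt lk; rewrite ka ltn_neqAle => /andP[].
Qed.

(** After averaging over the permutations of the rank class, the occupancies of its units are
    frozen, so each inner sum is a permanent to which the exponential bound applies. *)
Lemma rank_moment (R : realType) a :
  (\sum_s (\prod_(k in unit_rank a) (1 + occupancy s k (cb (s k)))) ^ rho)%N%:R
   <= N`!%:R * expR overlap_const%:R :> R.
Proof.
set A := unit_rank a; have A0 : 0 < #|A| `!%:R :> R by rewrite ltr0n fact_gt0.
rewrite -(ler_pM2l A0) -natrM sum_perm_average natr_sum.
apply: (@le_trans _ _ (\sum_(s : 'S_N) #|A| `!%:R * expR overlap_const%:R)); last first.
  by rewrite sumr_const card_Sn -[leLHS]mulr_natr -mulrA [X in _ * X <= _]mulrC.
apply: ler_sum => s _.
(* Subtracting 1 isolates the perturbation of the all-one matrix; its row sums are bounded by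
   [overlap_const]. *)
pose x k l := ((1 + occupancy s k (cb (s l))) ^ rho - 1)%N.
apply: le_trans (@sum_perm_on_prod1D_expR R _ A x overlap_const _) => [|k kA].
  rewrite ler_nat; apply: leq_sum => p pA.
  rewrite (big_morph (expn^~ rho) (fun u v => expnMn u v rho) (exp1n rho)).
  apply: eq_leq; apply: eq_bigr => k kA.
  by rewrite /x (occupancy_perm_on _ _ kA) // permM subnKC // expn_gt0.
apply: (@leq_trans (\sum_l (1 + 2 * rho) ^ rho * occupancy s k (cb (s l)))%N).
  rewrite big_mkcond; apply: leq_sum => l _; case: ifP => // _.
  rewrite /x; have := occupancy_le s k (cb (s l)).
  case: (occupancy _ _ _) => [|u] ule; first by rewrite exp1n.
  apply: leq_trans (leq_subr _ _) _.
  apply: (@leq_trans ((1 + 2 * rho) ^ rho)%N); last by rewrite leq_pmulr.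
  by rewrite leq_exp2r // leq_add2l.
by rewrite -big_distrr leq_mul2l sum_occupancy orbT.
Qed.

Lemma sum_contingency_fact_shift (R : realType) :
  (\sum_s \prod_i \prod_j (contingency rb cb s i j + E i j)`!)%N%:R <=
  (rho%:R * expR overlap_const%:R) * N`!%:R * (\prod_i \prod_j (E i j)`!)%N%:R :> R.
Proof.
under eq_bigr do rewrite contingency_occupancy.
rewrite -big_distrr natrM mulrC /= ler_wpM2r //.
apply: (@le_trans _ _ (\sum_(a < rho) (\sum_s
    (\prod_(k in unit_rank a) (1 + occupancy s k (cb (s k)))) ^ rho)%N%:R)).
  rewrite -natr_sum ler_nat exchange_big; apply: leq_sum => s _ /=.
  rewrite (partition_big (fun k => Ordinal (card_before k)) predT) //=.
  apply: leq_trans (prod_le_sum_expn _ rho_gt0).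
  apply: leq_prod => a _; apply: eq_leq; apply: eq_bigl => k.
  by rewrite inE -val_eqE.
apply: (@le_trans _ _ (\sum_(a < rho) N`!%:R * expR overlap_const%:R)).
  by apply: ler_sum => a _; exact: rank_moment.
by rewrite sumr_const card_ord -[leLHS]mulr_natr [leLHS]mulrC [N`!%:R * _]mulrC mulrA.
Qed.

End SecondMoment.

Lemma contingency_second_moment (R : realType) m n N rho (r : 'I_m -> nat)
    (c : 'I_n -> nat) (rb : 'I_N -> 'I_m) (cb : 'I_N -> 'I_n) :
  (0 < rho)%N -> splitting r rb -> splitting c cb ->
  (forall i, r i <= rho)%N -> (forall j, c j <= rho)%N ->
  (\sum_(s : 'S_N) \sum_(t : 'S_N) \prod_i \prod_j
     (contingency rb cb s i j + contingency rb cb t i j)`!)%N%:R <=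
  (rho%:R * expR (overlap_const rho)%:R) *
  (num_ctables r c * ((\prod_i (r i)`!) * (\prod_j (c j)`!)))%N%:R ^+ 2 :> R.
Proof.
move=> rho_gt0 rbP cbP r_le c_le; set mu := (num_ctables r c * _)%N.
rewrite exchange_big natr_sum /=.
apply: (@le_trans _ _ (\sum_(t : 'S_N) (rho%:R * expR (overlap_const rho)%:R) *
    N`!%:R * (\prod_i \prod_j (contingency rb cb t i j)`!)%N%:R)).
  apply: ler_sum => t _.
  apply: (sum_contingency_fact_shift (E := fun i j => contingency rb cb t i j)
    rho_gt0 rbP cbP r_le c_le) => i.
  by have [-> _] := contingency_ctables rbP cbP t.
(* The remaining sum over [t] is [mu], and [N! <= mu] turns the bound into a multiple of
   [mu ^ 2]. *)
rewrite -big_distrr -natr_sum /= (sum_contingency_fact rbP cbP) -/mu.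
rewrite expr2 mulrA ler_wpM2r // ler_wpM2l ?mulr_ge0 ?expR_ge0 //.
by rewrite ler_nat; exact: fact_le_sum_contingency.
Qed.

(** * Moments of independent exponential variables *)

Section GammaIntegral.
Variable R : realType.
Implicit Types (t : R) (d : nat).

(* [gamma_prim d] is the primitive of [t ^+ d * expR (- t)] vanishing at infinity,
   by integration by parts. *)
Fixpoint gamma_prim d : R -> R :=
  if d is e.+1 then fun t => d%:R * gamma_prim e t - t ^+ d * expR (- t)
  else fun t => - expR (- t).

Lemma is_derive_gamma_prim d t : is_derive t 1 (gamma_prim d) (t ^+ d * expR (- t)).
Proof.
have dN (u : R) : is_derive u (1 : R) (fun t : R => expR (- t)) (- expR (- u)).
  by rewrite -mulrN1; apply: is_derive1_comp.
elim: d => [|d IHd] /=.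
  by apply: (is_derive_eq (is_deriveN (dN t))); rewrite expr0 mul1r opprK.
have dX : is_derive t (1 : R) (fun t : R => t ^+ d.+1) (d.+1%:R * t ^+ d).
  by apply: DeriveDef; [exact: exprn_derivable | rewrite -derive1E exp_derive1].
apply: (is_derive_eq (is_deriveB (is_deriveZ d.+1%:R IHd) (is_deriveM dX (dN t)))).
rewrite /GRing.scale /= exprS; ring.
Qed.

Lemma gamma_prim0 d : gamma_prim d 0 = - d`!%:R.
Proof.
elim: d => [|d IHd] /=; first by rewrite oppr0 expR0.
by rewrite IHd exprS !mul0r subr0 mulrN factS natrM.
Qed.

(** The exponential dominates [t ^ (d + 1) / (d + 1)!], whence the majorant [(d + 1)! / t]. *)
Lemma cvg_exprM_expRN d : (t ^+ d * expR (- t)) @[t --> +oo] --> (0 : R).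
Proof.
apply: (@squeeze_cvgr _ _ _ _ (fun=> 0) (fun t => d.+1`!%:R * t^-1)).
- near=> t; have t0 : 0 < t by near: t; exact: nbhs_pinfty_gt.
  rewrite mulr_ge0 ?expR_ge0 ?exprn_ge0 ?(ltW t0) //=.
  rewrite expRN ler_pdivrMr ?expR_gt0 // mulrAC ler_pdivlMr // -exprSr.
  rewrite -ler_pdivrMl ?ltr0n ?fact_gt0 // mulrC.
  by apply: le_trans (expR_ge1Dxn d (ltW t0)); rewrite lerDr.
- exact: cvg_cst.
- rewrite -[X in _ --> X](mulr0 (d.+1`!%:R)); apply: cvgM; first exact: cvg_cst.
  apply/gtr0_cvgV0; first by near=> t; near: t; exact: nbhs_pinfty_gt.
  exact: cvg_id.
Unshelve. all: by end_near. Qed.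

Lemma cvg_gamma_prim d : gamma_prim d t @[t --> +oo] --> (0 : R).
Proof.
elim: d => [|d IHd] /=.
  rewrite -oppr0; apply: cvgN; exact: cvgr_expR.
rewrite -[X in _ --> X](subrr 0) -{1}(mulr0 d.+1%:R); apply: cvgB.
  by apply: cvgM => //; exact: cvg_cst.
exact: cvg_exprM_expRN.
Qed.

Lemma integral_exprM_expRN d :
  (\int[@lebesgue_measure R]_(t in `[0%R, +oo[) (t ^+ d * expR (- t))%:E = d`!%:R%:E)%E.
Proof.
have cont : continuous (fun t : R => t ^+ d * expR (- t)).
  move=> t; apply: cvgM; first exact: exprn_continuous.
  by apply: continuous_comp; [exact: continuousN | exact: continuous_expR].
rewrite (@ge0_continuous_FTC2y _ _ (gamma_prim d) _ 0) //.
- by rewrite gamma_prim0 EFinN oppeK add0e.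
- by move=> t t0; rewrite mulr_ge0 ?expR_ge0 ?exprn_ge0.
- exact: continuous_subspaceT.
- exact: cvg_gamma_prim.
- by move=> t _; apply: ex_derive; exact: is_derive_gamma_prim.
- apply: cvg_at_right_filter; apply: differentiable_continuous.
  apply/derivable1_diffP; apply: ex_derive; exact: is_derive_gamma_prim.
- by move=> t _; rewrite derive1E; apply: derive_val; exact: is_derive_gamma_prim.
Qed.

Lemma integral_mulrn_exprn d t : 0 <= t ->
  (\int[@lebesgue_measure R]_(u in `[0%R, t]) (d.+1%:R * u ^+ d)%:E = (t ^+ d.+1)%:E)%E.
Proof.
rewrite le_eqVlt => /predU1P[<-|t0].
  by rewrite set_itv1 integral_set1 expr0n.
have cont : continuous (fun u : R => d.+1%:R * u ^+ d).
  by move=> u; apply: cvgM; [exact: cvg_cst | exact: exprn_continuous].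
have contX : continuous (fun u : R => u ^+ d.+1) by exact: exprn_continuous.
rewrite (@continuous_FTC2 _ _ (fun u => u ^+ d.+1)) //.
- by rewrite expr0n sube0.
- exact: continuous_subspaceT.
- split.
  + by move=> u _; exact: exprn_derivable.
  + by apply: cvg_at_right_filter; exact: contX.
  + by apply: cvg_at_left_filter; exact: contX.
- by move=> u _; rewrite exp_derive1.
Qed.
End GammaIntegral.

Section Moments.
Context d (Omega : measurableType d) (R : realType) (P : probability Omega R).
Local Open Scope ereal_scope.
Let mu : {measure set (measurableTypeR R) -> \bar R} := @lebesgue_measure R.

(* Tonelli applied to [X ^ k.+1 = \int_(0 <= t <= X) k.+1 * t ^ k]. *)
Lemma standard_exponential_moment (X : {RV P >-> R}) k :
  standard_exponential P X -> (forall w, 0 <= X w)%R ->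
  \int[P]_w (X w ^+ k)%:E = k`!%:R%:E.
Proof.
move=> expX X0; case: k => [|k].
  under eq_integral do rewrite expr0.
  by rewrite integral_cst // mul1e; exact: probability_setT.
pose h (t : R) : R := (k.+1%:R * t ^+ k)%R.
pose S := [set p : Omega * measurableTypeR R | (0 <= p.2 <= X p.1)%R].
have mS : measurable S.
  rewrite (_ : S = (fun p : Omega * measurableTypeR R => 0 <= p.2)%R @^-1` [set true] `&`
     (fun p : Omega * measurableTypeR R => p.2 <= X p.1)%R @^-1` [set true]); last first.
    by rewrite /S; apply/seteqP; split=> p /=; [case/andP=> -> ->|case=> -> ->].
  apply: measurableI.
    have : measurable_fun setT (fun p : Omega * measurableTypeR R => 0 <= p.2)%R.
      exact: measurable_fun_ler.
    by move=> /(_ measurableT [set true]); rewrite setTI; exact.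
  have : measurable_fun setT (fun p : Omega * measurableTypeR R => p.2 <= X p.1)%R.
    by apply: measurable_fun_ler => //; exact: measurableT_comp.
  by move=> /(_ measurableT [set true]); rewrite setTI; exact.
pose f (p : Omega * measurableTypeR R) : \bar R := (\1_S p * h p.2)%:E.
have mf : measurable_fun setT f.
  apply/measurable_EFinP; apply: measurable_funM; first exact: measurable_indic.
  apply: measurable_funM => //.
  exact: measurable_funX.
have f0 p : 0 <= f p.
  rewrite lee_fin /f indicE; case: (boolP (p \in S)); rewrite ?mul0r // mul1r.
  by rewrite inE => /andP[p0 _]; rewrite mulr_ge0 // exprn_ge0.
transitivity (\int[P]_w \int[mu]_t f (w, t)).
  apply: eq_integral => w _; rewrite -(integral_mulrn_exprn k (X0 w)).
  rewrite integral_mkcond; apply: eq_integral => t _.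
  rewrite /f patchE mem_setE in_itv /= indicE.
  have -> : ((w, t) \in S) = (0 <= t <= X w)%R by apply/idP/idP; rewrite inE.
  by case: ifP => _; rewrite ?mul1r // mul0r.
rewrite (fubini_tonelli (m1 := P) (m2 := @lebesgue_measure R) f mf f0).
transitivity (\int[mu]_(t in `[0%R, +oo[) (k.+1%:R * (t ^+ k * expR (- t)))%:E).
  rewrite [RHS]integral_mkcond; apply: eq_integral => t _.
  rewrite patchE mem_setE in_itv /= andbT; case: ifPn => t0; last first.
    apply: integral0_eq => w _; rewrite /f indicE memNset ?mul0r //=.
    by rewrite /S /= (negPf t0).
  transitivity (\int[P]_w ((h t)%:E * (\1_[set w | t <= X w]%R w)%:E)).
    apply: eq_integral => w _; rewrite /f -EFinM mulrC !indicE.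
    congr (_ * _)%:E; congr (nat_of_bool _)%:R.
    by apply/idP/idP; rewrite !inE /S /= t0.
  have mt : measurable [set w | t <= X w]%R.
    rewrite (_ : [set w | t <= X w]%R = X @^-1` `[t, +oo[).
      exact: measurable_funPTI.
    by apply/seteqP; split => w; rewrite /= in_itv /= andbT.
  rewrite ge0_integralZl //.
  - rewrite integral_indic // setIT; transitivity ((h t)%:E * (expR (- t))%:E).
      by congr (_ * _); exact: expX.
    by rewrite -EFinM /h mulrA.
  - by apply/measurable_EFinP; exact: measurable_indic.
  - by rewrite lee_fin mulr_ge0 // exprn_ge0.
under eq_integral do rewrite EFinM.
rewrite ge0_integralZl //.
- by rewrite integral_exprM_expRN -EFinM -natrM -factS.
- apply/measurable_EFinP; apply: measurable_funM.
    exact: measurable_funX.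
  by apply: measurableT_comp => //; exact: measurable_funN.
- move=> t; rewrite /= in_itv /= andbT => t0.
  by rewrite lee_fin mulr_ge0 ?expR_ge0 ?exprn_ge0.
Qed.
End Moments.

Section Independence.
Context d (Omega : measurableType d) (R : realType) (P : probability Omega R).
Local Open Scope ereal_scope.

Section Factor.
Import HBNNSimple.
Variables (G : Omega -> R) (Y : {RV P >-> R}) (c : R).
Hypotheses (mG : measurable_fun setT G) (G0 : forall w, (0 <= G w)%R) (c0 : (0 <= c)%R).
Hypothesis factor_indic : forall B : set R, measurable B ->
  \int[P]_w (G w * \1_B (Y w))%:E = c%:E * P (Y @^-1` B).

Let factor_nnsfun (h : {nnsfun R >-> R}) :
  \int[P]_w (G w * h (Y w))%:E = c%:E * \int[P]_w (h (Y w))%:E.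
Proof.
have mY (r : R) : measurable (h @^-1` [set r]) by [].
have mI (r : R) : measurable_fun setT (fun w => \1_(h @^-1` [set r]) (Y w) : R).
  by apply: measurableT_comp => //; exact: measurable_indic.
have hE w : (h (Y w))%:E = \sum_(r \in range h) (r * \1_(h @^-1` [set r]) (Y w))%:E.
  by rewrite fimfunE -fsumEFin.
have GhE w : (G w * h (Y w))%:E =
    \sum_(r \in range h) (r * (G w * \1_(h @^-1` [set r]) (Y w)))%:E.
  rewrite EFinM hE ge0_mule_fsumr; last by move=> r; rewrite nnfun_muleindic_ge0.
  by apply: eq_fsbigr => r _; rewrite -EFinM mulrCA.
under eq_integral do rewrite GhE.
under [in RHS]eq_integral do rewrite hE.
rewrite ge0_integral_fsum //; last 2 first.
- by move=> r; apply/measurable_EFinP; do 2 apply: measurable_funM => //.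
- move=> r w _; rewrite mulrCA EFinM mule_ge0 ?lee_fin //.
  by have := nnfun_muleindic_ge0 h r (Y w); rewrite lee_fin.
rewrite ge0_integral_fsum //; last 2 first.
- by move=> r; apply/measurable_EFinP; apply: measurable_funM => //.
- by move=> r w _; rewrite nnfun_muleindic_ge0.
rewrite ge0_mule_fsumr; last first.
  by move=> r; apply: integral_ge0 => w _; rewrite nnfun_muleindic_ge0.
apply: eq_fsbigr => r; rewrite inE => -[x _ hx].
have r0 : (0 <= r)%R by rewrite -hx.
under eq_integral do rewrite EFinM.
rewrite ge0_integralZl //; last 2 first.
- by apply/measurable_EFinP; exact: measurable_funM.
- by move=> w _; rewrite lee_fin mulr_ge0.
rewrite factor_indic //.
under [in RHS]eq_integral do rewrite EFinM.
rewrite ge0_integralZl //; last first.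
  by apply/measurable_EFinP.
rewrite muleCA; congr (_ * (_ * _)).
rewrite (_ : (fun w => _) = (fun w => (\1_(Y @^-1` (h @^-1` [set r])) w)%:E)) //.
by rewrite integral_indic ?setIT //; exact: measurable_funPTI.
Qed.

(** The factorization passes from indicators to simple functions, then to nonnegative functions by
    monotone convergence. In the application, [G] is the product of the factors of the other
    variables. *)
Lemma ge0_integral_factor (h : R -> R) : measurable_fun setT h ->
  (forall x, 0 <= h x)%R ->
  \int[P]_w (G w * h (Y w))%:E = c%:E * \int[P]_w (h (Y w))%:E.
Proof.
move=> mh h0; have mEh : measurable_fun setT (EFin \o h) by exact/measurable_EFinP.
pose f_ := nnsfun_approx measurableT mEh.
have cvgf x : (f_ n x)%:E @[n --> \oo] --> (h x)%:E.
  by apply: (@cvg_nnsfun_approx _ _ _ _ measurableT _ mEh) => // y _; rewrite lee_fin.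
have mf n : measurable_fun setT (fun w => f_ n (Y w)) by exact: measurableT_comp.
have ndf (x : R) a b : (a <= b)%N -> (f_ a x <= f_ b x)%R.
  by move=> ab; exact/lefP/nd_nnsfun_approx.
transitivity (limn (fun n => \int[P]_w (G w * f_ n (Y w))%:E)).
  rewrite -monotone_convergence //.
  - apply: eq_integral => w _; apply/esym/cvg_lim => //.
    rewrite (_ : (fun n => _) = (fun n => (G w)%:E * (f_ n (Y w))%:E)) //.
    by rewrite EFinM; apply: cvgeZl => //; exact: cvgf.
  - by move=> n; apply/measurable_EFinP; exact: measurable_funM.
  - by move=> n w _; rewrite lee_fin mulr_ge0.
  - by move=> w _ a b ab; rewrite lee_fin ler_wpM2l // ndf.
rewrite (_ : \int[P]_w (h (Y w))%:E = limn (fun n => \int[P]_w (f_ n (Y w))%:E)); last first.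
  rewrite -monotone_convergence //.
  - by apply: eq_integral => w _; apply/esym/cvg_lim => //; exact: cvgf.
  - by move=> n; apply/measurable_EFinP; exact: mf.
  - by move=> n w _; rewrite lee_fin.
  - by move=> w _ a b ab; rewrite lee_fin ndf.
rewrite -limeMl //.
  by congr (limn _); apply/funext => n /=; rewrite factor_nnsfun.
apply/ereal_nondecreasing_is_cvgn => a b ab; apply: ge0_le_integral => //.
- by move=> x _; rewrite lee_fin.
- by apply/measurable_EFinP; exact: mf.
- by apply/measurable_EFinP; exact: mf.
- by move=> x _; rewrite lee_fin ndf.
Qed.
End Factor.

Variables (K : finType) (X : K -> {RV P >-> R}).
Hypothesis indepX : mutually_independent P (fun k => X k : Omega -> R).

Lemma measurable_fun_prod_comp (J : pred K) (g : K -> R -> R) :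
  (forall k, measurable_fun setT (g k)) ->
  measurable_fun setT (fun w => \prod_(k | J k) g k (X k w))%R.
Proof.
move=> mg; under eq_fun do rewrite -big_filter.
by apply: measurable_prod => k _; exact: measurableT_comp.
Qed.

(* Independence is the case where all [g k] are indicators; they are replaced by
   general functions one at a time. *)
Lemma integral_prod_indep (g : K -> R -> R) (a : K -> R) :
  (forall k, measurable_fun setT (g k)) -> (forall k x, 0 <= g k x)%R ->
  (forall k, \int[P]_w (g k (X k w))%:E = (a k)%:E) ->
  \int[P]_w (\prod_k g k (X k w))%:E = (\prod_k a k)%:E.
Proof.
have : forall k, k \notin enum K -> exists2 B, measurable B & g k = \1_B.
  by move=> k; rewrite mem_enum.
elim: (enum K) g a => [|k0 s IHs] g a gI mg g0 ga.
  have /choice[B BP] : forall k, exists B, measurable B /\ g k = \1_B.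
    by move=> k; have [//|B mB gB] := gI k; exists B.
  have aP k : (a k)%:E = P (X k @^-1` B k).
    rewrite -ga (BP k).2 (_ : (fun w => _) = (fun w => (\1_(X k @^-1` B k) w)%:E)) //.
    by rewrite integral_indic ?setIT //; apply: measurable_funPTI => //; exact: (BP k).1.
  rewrite (eq_integral (fun w => (\1_(\bigcap_(k in [set` [set: K]%SET]) (X k @^-1` B k)) w)%:E)).
    rewrite integral_indic ?setIT //.
      transitivity (\prod_(k in [set: K]%SET) P (X k @^-1` B k)).
        by apply: indepX => k; exact: (BP k).1.
      rewrite -prodEFin; apply: eq_big => [k|k _]; rewrite ?inE //.
    apply: fin_bigcap_measurable; first exact: finite_finset.
    by move=> k _; apply: measurable_funPTI => //; exact: (BP k).1.
  move=> w _; congr EFin; rewrite indicE.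
  case: (boolP (w \in _)) => [/set_mem wB|/negP wB].
    rewrite big1 // => k _; rewrite (BP k).2 indicE mem_set //.
    by apply: wB; rewrite /= inE.
  have {}wB : ~ (\bigcap_(k in [set` [set: K]%SET]) (X k @^-1` B k)) w.
    by move=> ?; apply: wB; exact: mem_set.
  move: wB => /existsNP[k /not_implyP[_ wB]].
  by rewrite (bigD1 k) //= (BP k).2 indicE memNset // mul0r.
have a0 k : (0 <= a k)%R.
  by rewrite -lee_fin -ga; apply: integral_ge0 => w _; rewrite lee_fin.
have mgk k : measurable_fun setT (fun w => (g k (X k w))%:E).
  by apply/measurable_EFinP; exact: measurableT_comp.
under eq_integral do rewrite (bigD1 k0) //= mulrC.
rewrite (bigD1 k0) //= mulrC EFinM -[in RHS]ga.
apply: ge0_integral_factor => //.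
- exact: measurable_fun_prod_comp.
- by move=> w; apply: prodr_ge0.
- move=> B mB; have PB : \int[P]_w (\1_B (X k0 w))%:E = P (X k0 @^-1` B).
    rewrite (_ : (fun w => _) = (fun w => (\1_(X k0 @^-1` B) w)%:E)) //.
    by rewrite integral_indic ?setIT //; exact: measurable_funPTI.
  pose g' k := if k == k0 then \1_B : R -> R else g k.
  pose a' k := if k == k0 then fine (P (X k0 @^-1` B)) else a k.
  have := IHs g' a'; rewrite /g' /a'.
  rewrite (bigD1 k0) //= eqxx (eq_bigr a) => [H|k /negPf -> //].
  rewrite -[P _]fineK ?fin_num_measure //; last exact: measurable_funPTI.
  rewrite -EFinM mulrC -H.
  + apply: eq_integral => w _; rewrite [in RHS](bigD1 k0) //= eqxx mulrC.
    by congr (_ * _)%:E; apply: eq_bigr => k /negPf ->.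
  + move=> k ks; have [_|kk0] := eqVneq k k0; first by exists B.
    by apply: gI; rewrite inE negb_or kk0.
  + by move=> k; case: eqP => // _; exact: measurable_indic.
  + by move=> k x; case: eqP => // _; rewrite indicE.
  + move=> k; case: eqP => [->|_]; last exact: ga.
    by rewrite PB fineK ?fin_num_measure //; exact: measurable_funPTI.
Qed.
End Independence.

(** * Concentration of the permanent estimator *)

Lemma chebyshev_moments d (Omega : measurableType d) (R : realType)
    (P : probability Omega R) (Y : Omega -> R) (mu V delta : R) :
  measurable_fun setT Y -> (forall w, 0 <= Y w) -> 0 <= mu -> 0 < delta ->
  (\int[P]_w (Y w)%:E = mu%:E)%E ->
  (\int[P]_w (Y w ^+ 2)%:E <= (mu ^+ 2 + V)%:E)%E ->
  (P [set w | (delta <= `|Y w - mu|)%R] <= (delta ^- 2 * V)%:E)%E.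
Proof.
move=> mY Y0 mu0 delta0 EY EY2.
have mS : measurable_fun setT (fun w => (Y w - mu) ^+ 2).
  by apply: measurable_funX; apply: measurable_funB.
have mB : measurable [set w | delta <= `|Y w - mu|].
  rewrite (_ : [set w | _] = (fun w : Omega => (delta <= `|Y w - mu|)%R) @^-1` [set true]) //.
  rewrite -[X in measurable X]setTI; apply: measurable_fun_ler => //.
  by apply: measurableT_comp => //; apply: measurable_funB.
have EJ : (\int[P]_w ((Y w - mu) ^+ 2)%:E <= V%:E)%E.
  (* Written as [(Y - mu) ^ 2 + 2 mu Y = Y ^ 2 + mu ^ 2], the expansion of the square involves only
     nonnegative integrands, so no integrability has to be shown. *)
  have : (\int[P]_w ((Y w - mu) ^+ 2)%:E + (2 * mu)%:E * \int[P]_w (Y w)%:E =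
      \int[P]_w (Y w ^+ 2)%:E + (mu ^+ 2)%:E)%E.
    rewrite -ge0_integralZl //; last 3 first.
    - exact/measurable_EFinP.
    - by move=> w _; rewrite lee_fin.
    - by rewrite lee_fin mulr_ge0.
    rewrite -ge0_integralD //; last 4 first.
    - by move=> w _; rewrite lee_fin sqr_ge0.
    - exact/measurable_EFinP.
    - by move=> w _; rewrite -EFinM lee_fin !mulr_ge0.
    - by under eq_fun do rewrite -EFinM; apply/measurable_EFinP; apply: measurable_funM.
    transitivity (\int[P]_w ((Y w ^+ 2)%:E + (mu ^+ 2)%:E))%E.
      by apply: eq_integral => w _; rewrite -EFinM -!EFinD; congr EFin; ring.
    rewrite ge0_integralD //; last 3 first.
    - by move=> w _; rewrite lee_fin sqr_ge0.
    - by apply/measurable_EFinP; exact: measurable_funX.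
    - by move=> w _; rewrite lee_fin sqr_ge0.
    congr (_ + _)%E; rewrite integral_cst //.
    by rewrite [X in (_ * X)%E](_ : _ = 1%E) ?mule1 //; exact: probability_setT.
  rewrite EY -EFinM => H.
  have : (\int[P]_w ((Y w - mu) ^+ 2)%:E + (2 * mu * mu)%:E <=
          V%:E + (2 * mu * mu)%:E)%E.
    rewrite H -EFinD; apply: le_trans (leeD2r _ EY2) _.
    by rewrite -EFinD lee_fin; rewrite le_eqVlt; apply/orP; left; apply/eqP; ring.
  by rewrite leeD2rE.
have : ((delta ^+ 2)%:E * P [set w | (delta <= `|Y w - mu|)%R] <= V%:E)%E.
  apply: le_trans EJ; rewrite -(setIT [set w | _]) -integral_indic //.
  rewrite -ge0_integralZl //; last 2 first.
  - by apply/measurable_EFinP; exact: measurable_indic.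
  - by rewrite lee_fin sqr_ge0.
  apply: ge0_le_integral => //.
  - by move=> w _; rewrite -EFinM lee_fin mulr_ge0 ?sqr_ge0 // indicE.
  - under eq_fun do rewrite -EFinM.
    by apply/measurable_EFinP; apply: measurable_funM => //; exact: measurable_indic.
  - exact/measurable_EFinP.
  move=> w _; rewrite -EFinM lee_fin indicE.
  case: (boolP (w \in _)) => [/set_mem /= dY|_]; last by rewrite mulr0 sqr_ge0.
  by rewrite mulr1 -(real_normK (num_real (Y w - mu))) ler_sqr ?nnegrE // ltW.
rewrite -lee_pdivlMl ?exprn_gt0 //.
Qed.

Section Estimator.
Variables (R : realType) (m n N M rho : nat).
Variables (r : 'I_m -> nat) (c : 'I_n -> nat) (rb : 'I_N -> 'I_m) (cb : 'I_N -> 'I_n).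
Hypotheses (rbP : splitting r rb) (cbP : splitting c cb).

Local Notation K := ('I_M * 'I_m * 'I_n)%type.

(** Exponent of the variable [x] in the monomial that [sg] contributes to the permanent of copy [s];
    variables of other copies do not occur in it. *)
Definition mono_exp (s : 'I_M) (sg : 'S_N) (x : K) : nat :=
  ((x.1.1 == s) * contingency rb cb sg x.1.2 x.2)%N.

Lemma prod_mono_exp (A : comPzRingType) (f : K -> A) s (sg : 'S_N) :
  \prod_k f (s, rb k, cb (sg k)) = \prod_x f x ^+ mono_exp s sg x.
Proof.
rewrite (partition_big (fun k => (s, rb k, cb (sg k))) predT) //=.
apply: eq_bigr => -[[t i] j] _.
rewrite (eq_bigr (fun=> f (t, i, j))) => [|k /eqP -> //].
rewrite prodr_const; congr (_ ^+ _); rewrite /mono_exp /= mxE.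
rewrite [t == s]eq_sym; have [->|st] := eqVneq s t.
  by rewrite mul1n; apply: eq_card => k; rewrite !inE unfold_in !xpair_eqE eqxx.
rewrite mul0n; apply: eq_card0 => k.
by rewrite unfold_in !xpair_eqE (negPf st).
Qed.

Lemma prod_fact_slice (s : 'I_M) (f : 'I_m -> 'I_n -> nat) (e : K -> nat) :
  (forall i j, e (s, i, j) = f i j) ->
  (forall t i j, t != s -> e (t, i, j) = 0%N) ->
  (\prod_x (e x)`! = \prod_i \prod_j (f i j)`!)%N.
Proof.
move=> es et.
rewrite (eq_bigr (fun x => (e (x.1.1, x.1.2, x.2))`!)) => [|[[? ?] ?] //].
rewrite -(pair_bigA _ (fun ti j => (e (ti.1, ti.2, j))`!)) /=.
rewrite -(pair_bigA _ (fun t i => \prod_j (e (t, i, j))`!)%N) /= (bigD1 s) //=.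
rewrite [X in (_ * X)%N]big1 ?muln1.
  by apply: eq_bigr => i _; apply: eq_bigr => j _; rewrite es.
move=> t ts; rewrite big1 // => i _; rewrite big1 // => j _; by rewrite et.
Qed.

Lemma prod_fact_mono s sg :
  (\prod_x (mono_exp s sg x)`! = \prod_i \prod_j (contingency rb cb sg i j)`!)%N.
Proof.
apply: (@prod_fact_slice s) => [i j|t i j /negPf ts]; rewrite /mono_exp /=.
  by rewrite eqxx mul1n.
by rewrite ts.
Qed.

(** For [s != t] the two monomials share no variable, so by [mixed_moment] their joint moment is the
    product of the two moments. *)
Lemma prod_fact_mono2 s sg t ta :
  (\prod_x (mono_exp s sg x + mono_exp t ta x)`! =
   if s == t then \prod_i \prod_j (contingency rb cb sg i j + contingency rb cb ta i j)`!
   else (\prod_i \prod_j (contingency rb cb sg i j)`!) *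
        (\prod_i \prod_j (contingency rb cb ta i j)`!))%N.
Proof.
have [<-|st] := eqVneq s t.
  apply: (prod_fact_slice (s := s)
    (f := fun i j => contingency rb cb sg i j + contingency rb cb ta i j)%N)
    => [i j|u i j /negPf us]; rewrite /mono_exp /=.
    by rewrite eqxx !mul1n.
  by rewrite us.
rewrite -(prod_fact_mono s) -(prod_fact_mono t) -big_split; apply: eq_bigr => -[[u i] j] _.
rewrite /mono_exp /=; have [->|us] := eqVneq u s.
  by rewrite (negPf st) mul0n addn0 muln1.
by rewrite mul0n add0n mul1n.
Qed.

Let mu : nat := (num_ctables r c * ((\prod_i (r i)`!) * (\prod_j (c j)`!)))%N.
Let kappa : R := rho%:R * expR (overlap_const rho)%:R.

Context d (Omega : measurableType d) (P : probability Omega R).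
Variable X : K -> {RV P >-> R}.
Hypotheses (X0 : forall x w, 0 <= X x w).
Hypothesis expX : forall x, standard_exponential P (X x).
Hypothesis indepX : mutually_independent P (fun x => X x : Omega -> R).

Lemma mixed_moment (e : K -> nat) :
  (\int[P]_w (\prod_x X x w ^+ e x)%:E = (\prod_x (e x)`!)%N%:R%:E)%E.
Proof.
(* [integral_prod_indep] wants functions that are nonnegative on the whole line, so the power of [y]
   is replaced by that of [max y 0], which agrees with it on the values of [X]. *)
have maxX x w : Num.max (X x w) 0 = X x w by apply/max_idPl.
rewrite natr_prod.
under eq_integral do under eq_bigr => x _ do rewrite -(maxX x).
apply: (integral_prod_indep indepX (g := fun x y => Num.max y 0 ^+ e x)) => [x|x y|x].
- by apply: measurable_funX; apply: measurable_maxr.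
- by rewrite exprn_ge0 // le_max lexx orbT.
- under eq_integral do rewrite maxX.
  by apply: standard_exponential_moment => // w.
Qed.

Definition per_sum w := \sum_(s < M) permanent (block_mx_of rb cb (fun i j => X (s, i, j) w)).

Lemma per_sumE w : per_sum w = \sum_(s < M) \sum_(sg : 'S_N) \prod_x X x w ^+ mono_exp s sg x.
Proof.
apply: eq_bigr => s _; apply: eq_bigr => sg _.
by rewrite -(prod_mono_exp (X ^~ w)); apply: eq_bigr => k _; rewrite mxE.
Qed.

Lemma measurable_mono (e : K -> nat) :
  measurable_fun setT (fun w => \prod_x X x w ^+ e x).
Proof.
apply: (measurable_fun_prod_comp X predT (g := fun x y => y ^+ e x)) => x.
exact: exprn_measurable.
Qed.

Lemma measurable_per_sum : measurable_fun setT per_sum.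
Proof.
have -> : per_sum = (fun w => \sum_(s < M) \sum_(sg : 'S_N) \prod_x X x w ^+ mono_exp s sg x).
  by apply/funext => w; rewrite per_sumE.
by do 2![apply: measurable_sum => ?]; exact: measurable_mono.
Qed.

Lemma per_sum_ge0 w : 0 <= per_sum w.
Proof.
rewrite per_sumE; do 2![apply: sumr_ge0 => ? _]; apply: prodr_ge0 => x _.
exact: exprn_ge0.
Qed.

Lemma integral_per_sum : (\int[P]_w (per_sum w)%:E = (M%:R * mu%:R)%:E)%E.
Proof.
under eq_integral do rewrite per_sumE pair_bigA /= -sumEFin.
rewrite ge0_integral_sum //=; last 2 first.
- by move=> ? ; apply/measurable_EFinP; exact: measurable_mono.
- by move=> ? w _; rewrite lee_fin; apply: prodr_ge0 => x _; exact: exprn_ge0.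
under eq_bigr do rewrite mixed_moment prod_fact_mono.
rewrite sumEFin -(pair_bigA _ (fun s sg => (\prod_i \prod_j (contingency rb cb sg i j)`!)%N%:R)) /=.
rewrite sumr_const card_ord -natr_sum (sum_contingency_fact rbP cbP).
by congr EFin; rewrite -[LHS]mulr_natl.
Qed.

Hypotheses (rho_gt0 : (0 < rho)%N).
Hypotheses (r_le : forall i, (r i <= rho)%N) (c_le : forall j, (c j <= rho)%N).

(** Two distinct copies contribute exactly [mu ^ 2], two equal ones at most [kappa * mu ^ 2]; hence
    the variance grows like [M] and not like [M ^ 2]. *)
Lemma integral_per_sum_sqr :
  (\int[P]_w (per_sum w ^+ 2)%:E <= ((M%:R * mu%:R) ^+ 2 + M%:R * (kappa * mu%:R ^+ 2))%:E)%E.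
Proof.
pose J := (('I_M * 'S_N) * ('I_M * 'S_N))%type.
have sqE w : per_sum w ^+ 2 = \sum_(y : J)
    \prod_x X x w ^+ (mono_exp y.1.1 y.1.2 x + mono_exp y.2.1 y.2.2 x).
  rewrite per_sumE pair_bigA /= expr2 big_distrlr pair_bigA /=.
  apply: eq_bigr => y _; rewrite -big_split; apply: eq_bigr => x _.
  by rewrite exprD.
under eq_integral do rewrite sqE -sumEFin.
rewrite ge0_integral_sum //=; last 2 first.
- by move=> ? ; apply/measurable_EFinP; exact: measurable_mono.
- by move=> ? w _; rewrite lee_fin; apply: prodr_ge0 => x _; exact: exprn_ge0.
under eq_bigr do rewrite mixed_moment prod_fact_mono2.
rewrite sumEFin lee_fin.
pose F s sg t ta : R := (if s == t :> 'I_M then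
    \prod_i \prod_j (contingency rb cb sg i j + contingency rb cb ta i j)`!
   else (\prod_i \prod_j (contingency rb cb sg i j)`!) *
        (\prod_i \prod_j (contingency rb cb ta i j)`!))%N%:R.
rewrite -(pair_bigA _ (fun x y => F x.1 x.2 y.1 y.2)) /=.
rewrite -(pair_bigA _ (fun s sg => \sum_y F s sg y.1 y.2)) /=.
under eq_bigr do under eq_bigr do rewrite -(pair_bigA _ (fun t ta => F _ _ t ta)) /=.
under eq_bigr do rewrite exchange_big /=.
(* Allowing [mu ^ 2] on the diagonal as well completes the square [(M * mu) ^ 2]. *)
apply: (@le_trans _ _ (\sum_(s < M) \sum_(t < M)
    (mu%:R ^+ 2 + (s == t)%:R * (kappa * mu%:R ^+ 2)))).
  apply: ler_sum => s _; apply: ler_sum => t _; rewrite /F.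
  have [st|st] := eqVneq s t; last first.
    rewrite mul0r addr0; under eq_bigr do under eq_bigr do rewrite natrM.
    under eq_bigr do rewrite -big_distrr /=.
    by rewrite -big_distrl /= -!natr_sum (sum_contingency_fact rbP cbP) -expr2.
  rewrite mul1r; under eq_bigr do rewrite -natr_sum; rewrite -natr_sum.
  apply: le_trans (contingency_second_moment R rho_gt0 rbP cbP r_le c_le) _.
  by rewrite lerDr sqr_ge0.
under eq_bigr do rewrite big_split /= sumr_const card_ord -big_distrl /=.
rewrite big_split /= sumr_const card_ord -big_distrl /=.
rewrite [X in _ + X * _ <= _](_ : _ = M%:R).
  by rewrite lerD2r -mulrnA -[leLHS]mulr_natl natrM exprMn expr2.
under eq_bigr => s _.
  rewrite (bigD1 s) //= eqxx big1 ?addr0 => [|t]; last by rewrite eq_sym => /negPf ->.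
  over.
by rewrite sumr_const card_ord.
Qed.

Lemma per_sum_concentration (eps : R) : 0 < eps -> (0 < M)%N -> (0 < mu)%N ->
  (P [set w | (eps * (M%:R * mu%:R) <= `|per_sum w - M%:R * mu%:R|)%R] <=
    (kappa / (M%:R * eps ^+ 2))%:E)%E.
Proof.
move=> eps0 M0 mu0.
have Mmu0 : 0 < M%:R * mu%:R :> R by rewrite mulr_gt0 ?ltr0n.
apply: le_trans (chebyshev_moments measurable_per_sum per_sum_ge0 (ltW Mmu0) _
  integral_per_sum integral_per_sum_sqr) _; first exact: mulr_gt0.
rewrite lee_fin le_eqVlt; apply/orP; left; apply/eqP.
by field; rewrite !pnatr_eq0 -!lt0n M0 mu0 gt_eqF.
Qed.
End Estimator.

Section PositivePart.
Context d (Omega : measurableType d) (R : realType) (P : probability Omega R).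

(** [standard_exponential] prescribes the tail for [t >= 0] only, so a variable may be negative on a
    null event. Moments are computed for the positive part, which has the same tail and agrees with
    the variable almost surely. *)
Definition pos_part (X : {RV P >-> R}) : {RV P >-> R} := (X^\+)%R.

Lemma pos_partE (X : {RV P >-> R}) w : pos_part X w = Num.max (X w) 0.
Proof. by []. Qed.

Lemma standard_exponential_pos_part (X : {RV P >-> R}) :
  standard_exponential P X -> standard_exponential P (pos_part X).
Proof.
move=> expX t; rewrite le_eqVlt => /predU1P[<-|t0].
  rewrite oppr0 expR0 (_ : [set w | _] = setT) ?probability_setT //.
  by apply/seteqP; split=> w //= _; rewrite pos_partE le_max lexx orbT.
rewrite -(expX t (ltW t0)); congr (P _); apply/seteqP.
by split=> w /=; rewrite pos_partE le_max (leNgt t 0) t0 orbF.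
Qed.

Lemma mutually_independent_pos_part (K : finType) (X : K -> {RV P >-> R}) :
  mutually_independent P (fun k => X k : Omega -> R) ->
  mutually_independent P (fun k => pos_part (X k) : Omega -> R).
Proof.
move=> indepX J B mB.
apply: (indepX J (fun k => (fun x => Num.max x 0) @^-1` B k)) => k.
rewrite -[X in measurable X]setTI.
by apply: measurable_maxr => //; exact: mB.
Qed.

Lemma standard_exponential_ge0_ae (K : finType) (X : K -> {RV P >-> R}) :
  mutually_independent P (fun k => X k : Omega -> R) ->
  (forall k, standard_exponential P (X k)) ->
  P (\bigcap_(k in [set` [set: K]%SET]) (X k @^-1` `[0, +oo[)) = 1%E.
Proof.
move=> indepX expX; rewrite (indepX [set: K]%SET (fun=> `[0, +oo[%classic)) //.
rewrite big1 // => k _.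
transitivity (P [set w | 0 <= X k w]); last by rewrite expX // oppr0 expR0.
by congr (P _); apply/seteqP; split=> w /=; rewrite in_itv /= andbT.
Qed.
End PositivePart.

Lemma measurable_approximates d (Omega : measurableType d) (R : realType)
    (Y : Omega -> R) (eps T : R) :
  measurable_fun setT Y -> measurable [set w | approximates eps T (Y w)].
Proof.
move=> mY; rewrite (_ : [set w | _] =
  (fun w : Omega => (`|Y w - T| <= eps * T)%R) @^-1` [set true]) //.
rewrite -[X in measurable X]setTI; apply: measurable_fun_ler => //.
by apply: measurableT_comp => //; apply: measurable_funB.
Qed.

Lemma num_ctables_gt0 m n N (r : 'I_m -> nat) (c : 'I_n -> nat)
    (rb : 'I_N -> 'I_m) (cb : 'I_N -> 'I_n) :
  splitting r rb -> splitting c cb -> (0 < num_ctables r c)%N.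
Proof.
move=> rbP cbP; have := fact_le_sum_contingency rbP cbP.
by case: (num_ctables r c) => //; rewrite mul0n leqNgt fact_gt0.
Qed.

Theorem permanent_mean_approximates (R : realType) (rho : nat) (p : R)
    (rho_gt0 : (0 < rho)%N) (p_lt1 : p < 1) :
  exists C : R, 0 < C /\
    forall (eps : R), 0 < eps ->
    forall (m n N : nat) (r : 'I_m -> nat) (c : 'I_n -> nat),
      (forall i, (0 < r i <= rho)%N) -> (forall j, (0 < c j <= rho)%N) ->
    forall (rb : 'I_N -> 'I_m) (cb : 'I_N -> 'I_n),
      splitting r rb -> splitting c cb ->
    forall M : nat, Posz M = Num.ceil (C * eps ^- 2) ->
    forall (d : measure_display) (Omega : measurableType d)
      (P : probability Omega R)
      (gamma : 'I_M -> 'I_m -> 'I_n -> {RV P >-> R}),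
      (forall s i j, standard_exponential P (gamma s i j)) ->
      mutually_independent P
        (fun k : 'I_M * 'I_m * 'I_n => gamma k.1.1 k.1.2 k.2 : Omega -> R) ->
    (p%:E <= P [set w | approximates eps (num_ctables r c)%:R
       (permanent_mean r c (fun s =>
          block_mx_of rb cb (fun i j => gamma s i j w) : 'M[R]_N))])%E.
Proof.
pose kappa : R := rho%:R * expR (overlap_const rho)%:R.
have kappa0 : 0 < kappa by rewrite mulr_gt0 ?expR_gt0 ?ltr0n.
have q0 : 0 < 1 - p by rewrite subr_gt0.
(* With this constant, [M >= C / eps ^ 2] makes the failure bound [kappa / (M * eps ^ 2)] at most
   [1 - p]. *)
exists (kappa / (1 - p)); split; first exact: divr_gt0.
move=> eps eps0 m n N r c rb_le cb_le rb cb rbP cbP M MC d Omega P gamma expg indg.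
have CM : kappa / (1 - p) * eps ^- 2 <= M%:R.
  have := Num.Theory.ceil_ge (kappa / (1 - p) * eps ^- 2); rewrite -MC; exact.
have M0 : (0 < M)%N.
  by rewrite -(ltr0n R); apply: lt_le_trans CM; rewrite mulr_gt0 ?divr_gt0 // invr_gt0 exprn_gt0.
pose g (x : 'I_M * 'I_m * 'I_n) := gamma x.1.1 x.1.2 x.2.
pose X x := pos_part (g x).
have T0 := num_ctables_gt0 rbP cbP.
set a := ((\prod_i (r i)`!) * (\prod_j (c j)`!))%N.
have a0 : (0 < a)%N.
  by rewrite muln_gt0; apply/andP; split; apply: prodn_gt0 => ?; exact: fact_gt0.
pose good := [set w | approximates eps (num_ctables r c)%:R
       (permanent_mean r c (fun s =>
          block_mx_of rb cb (fun i j => gamma s i j w) : 'M[R]_N))].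
have meanE w : permanent_mean r c (fun s => block_mx_of rb cb (fun i j => gamma s i j w) : 'M[R]_N)
    = a%:R^-1 * (M%:R^-1 * per_sum rb cb (fun x => g x) w) by [].
have mgood : measurable good.
  apply: measurable_approximates; under eq_fun do rewrite meanE.
  by do 2![apply: measurable_funM => //]; exact: measurable_per_sum.
pose mu := (num_ctables r c * a)%N.
pose bad := [set w | eps * (M%:R * mu%:R) <= `|per_sum rb cb X w - M%:R * mu%:R|].
have badP : (P bad <= (1 - p)%:E)%E.
  apply: le_trans (per_sum_concentration (rho := rho) rbP cbP _ _ _ _ _ _ eps0 M0 _) _ => //.
  - by move=> x w; rewrite pos_partE le_max lexx orbT.
  - by move=> x; apply: standard_exponential_pos_part; exact: expg.
  - exact: mutually_independent_pos_part.
  - by move=> i; have /andP[] := rb_le i.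
  - by move=> i; have /andP[] := cb_le i.
  - by rewrite muln_gt0 T0.
  rewrite lee_fin -/kappa ler_pdivrMr ?mulr_gt0 ?ltr0n ?exprn_gt0 //.
  by move: CM; rewrite ler_pdivrMr ?exprn_gt0 // ler_pdivrMr // [(1 - p) * _]mulrC.
have mbad : measurable bad.
  rewrite (_ : bad = (fun w : Omega => (eps * (M%:R * mu%:R) <=
    `|per_sum rb cb X w - M%:R * mu%:R|)%R) @^-1` [set true]) //.
  rewrite -[X in measurable X]setTI; apply: measurable_fun_ler => //.
  by apply: measurableT_comp => //; apply: measurable_funB => //; exact: measurable_per_sum.
pose pos := \bigcap_(k in [set` [set: 'I_M * 'I_m * 'I_n]%SET]) (g k @^-1` `[0, +oo[).
have posP : P pos = 1%E.
  by apply: standard_exponential_ge0_ae => // k; exact: expg.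
have mpos : measurable pos.
  apply: fin_bigcap_measurable; first exact: finite_finset.
  by move=> k _; exact: measurable_funPTI.
(* On [pos] the given variables equal their positive parts, so the concentration of the latter
   carries over; the complement of [pos] is null and costs no probability. *)
have sub : ~` (bad `|` ~` pos) `<=` good.
  move=> w; rewrite setCU setCK => -[/= /negP badw posw]; rewrite -ltNge in badw.
  rewrite /good /= /approximates meanE.
  have -> : per_sum rb cb (fun x => g x) w = per_sum rb cb X w.
    apply: eq_bigr => s _; congr (permanent _); apply/matrixP => k l; rewrite !mxE.
    rewrite pos_partE; apply/esym/max_idPl.
    by have := posw (s, rb k, cb l); rewrite /= in_itv /= andbT; apply; rewrite inE.
  have aM : 0 < (a%:R * M%:R : R) by rewrite mulr_gt0 ?ltr0n.
  rewrite -(ler_pM2l aM) -[X in X * `|_|](gtr0_norm aM) -normrM.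
  have -> : a%:R * M%:R * (a%:R^-1 * (M%:R^-1 * per_sum rb cb X w) - (num_ctables r c)%:R)
     = per_sum rb cb X w - M%:R * mu%:R.
    rewrite /mu natrM; field.
    by rewrite !pnatr_eq0 -!lt0n a0 M0.
  apply: le_trans (ltW badw) _.
  by rewrite /mu natrM le_eqVlt; apply/orP; left; apply/eqP; ring.
apply: (@le_trans _ _ (P (~` (bad `|` ~` pos)))); last first.
  apply: le_measure; rewrite ?inE //; apply: measurableC.
  by apply: measurableU => //; exact: measurableC.
rewrite probability_setC; last by apply: measurableU => //; exact: measurableC.
rewrite measureU0 //; [|exact: measurableC|]; last first.
  by transitivity (1 - P pos)%E; [exact: probability_setC | rewrite posP subee].
have badfin : P bad \is a fin_num by rewrite fin_num_measure.
have : (p%:E <= 1 - P bad)%E; last by [].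
by move: badP; rewrite -(fineK badfin) -EFinB !lee_fin lerBrDl lerBrDr addrC.
Qed.

(** * The recurrence for the number of contingency tables *)

Definition dec n (f : 'I_n -> nat) (i : 'I_n) (k : nat) : 'I_n -> nat :=
  fun x => if x == i then (f x - k)%N else f x.

Section Newton.
Variables (m n : nat) (r : 'I_m -> nat) (c : 'I_n -> nat).

Definition add_entry (i : 'I_m) (j : 'I_n) k (D : 'M[nat]_(m, n)) : 'M[nat]_(m, n) :=
  \matrix_(x, y) (D x y + k * ((x == i) && (y == j)))%N.

Lemma add_entry_inj i j k : injective (add_entry i j k).
Proof.
move=> D D' /matrixP DD; apply/matrixP => x y.
by have := DD x y; rewrite !mxE => /addIn.
Qed.

Lemma ctables_add_entry i j k D : (k <= r i)%N -> (k <= c j)%N ->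
  ctables r c (add_entry i j k D) <-> ctables (dec r i k) (dec c j k) D.
Proof.
move=> kr kc.
have rowE x : (\sum_y add_entry i j k D x y = \sum_y D x y + k * (x == i))%N.
  under eq_bigr do rewrite mxE; rewrite big_split -big_distrr /=; congr (_ + _ * _)%N.
  have [_|_] := eqVneq x i; last by rewrite big1.
  by rewrite (bigD1 j) //= eqxx big1 // => y /negPf ->.
have colE y : (\sum_x add_entry i j k D x y = \sum_x D x y + k * (y == j))%N.
  under eq_bigr do rewrite mxE; rewrite big_split -big_distrr /=; congr (_ + _ * _)%N.
  have [_|_] := eqVneq y j; last by rewrite big1 // => x _; rewrite andbF.
  by rewrite (bigD1 i) //= eqxx big1 // => x /negPf ->.
split=> -[rD cD]; split=> x.
- have := rD x; rewrite rowE /dec; case: eqP => [->|_]; lia.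
- have := cD x; rewrite colE /dec; case: eqP => [->|_]; lia.
- have := rD x; rewrite rowE /dec; case: eqP => [->|_]; lia.
- have := cD x; rewrite colE /dec; case: eqP => [->|_]; lia.
Qed.

(** Subtracting [k] from the entry at [(i, j)] is a bijection onto the tables with both margins
    lowered by [k]; when [k > c j], no entry of column [j] reaches [k]. *)
Lemma card_ctables_ge i j k : (k <= r i)%N ->
  (\sum_(D <- fset_set (ctables r c)) (k <= D i j)%N =
   if k <= c j then num_ctables (dec r i k) (dec c j k) else 0)%N.
Proof.
move=> kr; have fin := finite_ctables r c.
have fin1 := finite_ctables (dec r i k) (dec c j k).
rewrite -big_mkcond /= sum1_count -size_filter.
case: leqP => [kc|ck].
  rewrite /num_ctables -[RHS](size_map (add_entry i j k)); apply/perm_size/uniq_perm.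
  - by rewrite filter_uniq // fset_uniq.
  - by rewrite map_inj_uniq ?fset_uniq //; exact: add_entry_inj.
  move=> D; rewrite mem_filter in_fset_set //; apply/andP/mapP => [[kD]|[D' + ->]].
    rewrite inE => rcD; pose D' := \matrix_(x, y) (D x y - k * ((x == i) && (y == j)))%N.
    have DD' : D = add_entry i j k D'.
      apply/matrixP => x y; rewrite !mxE subnK //.
      by have [->|_] := eqVneq x i; have [->|_] := eqVneq y j; rewrite /= ?muln1 ?muln0.
    exists D' => //; rewrite in_fset_set // inE.
    by apply/ctables_add_entry => //; rewrite -DD'.
  rewrite in_fset_set // inE => /ctables_add_entry rcD.
  by split; [rewrite mxE !eqxx muln1 leq_addl|rewrite inE; exact: rcD].
apply/eqP; rewrite size_eq0 -[_ == _]negbK -has_filter; apply/hasPn => D.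
rewrite in_fset_set // inE => -[_ cD]; rewrite -ltnNge (leq_ltn_trans _ ck) //.
by rewrite -cD (bigD1 i) //= leq_addr.
Qed.

Lemma sum_ltn_minn a b : (\sum_(k < a) (k < b) = minn a b)%N.
Proof.
elim: a => [|a IHa]; first by rewrite big_ord0 min0n.
by rewrite big_ord_recr /= IHa; lia.
Qed.

(* Count the pairs of a table and a unit of its row [i], the unit being number
   [k.+1] in the entry at [(i, j)], and subtract [k.+1] from that entry. *)
Lemma num_ctables_newton i :
  (r i * num_ctables r c = \sum_(k < r i) \sum_(j < n)
    if k < c j then num_ctables (dec r i k.+1) (dec c j k.+1) else 0)%N.
Proof.
have fin := finite_ctables r c.
transitivity (\sum_(D <- fset_set (ctables r c)) \sum_j D i j)%N.
  rewrite big_seq (eq_bigr (fun=> r i)) => [|D]; last first.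
    by rewrite in_fset_set // inE => -[rD _].
  rewrite -big_seq big_const_seq count_predT iter_addn_0 mulnC.
  by [].
transitivity (\sum_(D <- fset_set (ctables r c)) \sum_j \sum_(k < r i) (k < D i j))%N.
  rewrite !big_seq; apply: eq_bigr => D; rewrite in_fset_set // inE => -[rD _].
  apply: eq_bigr => j _; rewrite sum_ltn_minn; apply/esym/minn_idPr.
  by rewrite -rD (bigD1 j) //= leq_addr.
rewrite exchange_big [RHS]exchange_big; apply: eq_bigr => j _ /=.
rewrite exchange_big; apply: eq_bigr => k _ /=.
exact: card_ctables_ge.
Qed.
End Newton.

Lemma num_ctables_row0 m n (c : 'I_n -> nat) :
  num_ctables (fun _ : 'I_m => 0%N) c = [forall j, c j == 0%N].
Proof.
rewrite /num_ctables; case: (boolP [forall j, c j == 0%N]) => [/forallP c0|].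
  rewrite (_ : ctables _ _ = [set const_mx 0%N]) ?fset_set1 ?cardfs1 //.
  apply/seteqP; split=> [D [rD _]|_ ->] /=.
    apply/matrixP => i j; rewrite mxE; apply/eqP; rewrite -leqn0 -(rD i).
    by rewrite (bigD1 j) //= leq_addr.
  split=> [i|j]; first by rewrite big1 // => j _; rewrite mxE.
  by rewrite (eqP (c0 j)) big1 // => i _; rewrite mxE.
rewrite negb_forall => /existsP[j cj].
rewrite (_ : ctables _ _ = set0) ?fset_set0 ?cardfs0 //.
apply/seteqP; split=> // D [rD cD] /=; move: cj; rewrite -cD big1 // => i _.
by apply/eqP; rewrite -leqn0 -(rD i) (bigD1 j) //= leq_addr.
Qed.

(* Coding the residual column sums in base [n + 1], and the value of a cell *)
Local Close Scope ring_scope.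
Local Close Scope classical_set_scope.

(* Columns of residual sum 0 have weight 0: they are not recorded in the code. *)
Definition wgt B t := if t is t'.+1 then B ^ t' else 0.

(** Digit [t] in base [n + 1] is the number of columns of sum [t + 1]: the code remembers [c] up to
    the order of the columns. *)
Definition code n (c : 'I_n -> nat) := \sum_j wgt n.+1 (c j).

Section Code.
Variables (n : nat) (c : 'I_n -> nat).
Local Notation B := n.+1.

(** No carry can occur: at most [n] columns contribute, each at most [B ^ (t - 1)], and [n < B]. *)
Lemma code_low_lt t : \sum_(j | c j <= t) wgt B (c j) < B ^ t.
Proof.
case: t => [|t].
  by rewrite big1 // => j; rewrite leqn0 => /eqP ->.
apply: (@leq_ltn_trans (\sum_(j < n) B ^ t)); last first.
  by rewrite sum_nat_const card_ord expnS ltn_mul2r expn_gt0 /=.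
rewrite big_mkcond; apply: leq_sum => j _; case: ifP => //.
by case: (c j) => // u ut; rewrite /= leq_pexp2l.
Qed.

Lemma code_lt rho : (forall j, c j <= rho) -> code c < B ^ rho.
Proof.
move=> c_le; rewrite /code; apply: leq_ltn_trans (code_low_lt rho).
by apply: eq_leq; apply: eq_bigl => j; rewrite c_le.
Qed.

Lemma code_mod t : code c %% B ^ t = \sum_(j | c j <= t) wgt B (c j).
Proof.
rewrite /code (bigID (fun j => c j <= t)) /= -modnDmr.
have /eqP -> : B ^ t %| \sum_(j | ~~ (c j <= t)) wgt B (c j).
  apply: dvdn_sum => j; rewrite -ltnNge; case: (c j) => // u tu.
  by rewrite /= dvdn_exp2l.
by rewrite addn0 modn_small // code_low_lt.
Qed.

Lemma code_digit t : code c %% B ^ t.+1 %/ B ^ t = #|[set j | c j == t.+1]%SET|.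
Proof.
rewrite code_mod (bigID (fun j => c j <= t)) /=.
have -> : \sum_(j | (c j <= t.+1) && (c j <= t)) wgt B (c j) =
          \sum_(j | c j <= t) wgt B (c j) by apply: eq_bigl => j; lia.
have -> : \sum_(j | (c j <= t.+1) && ~~ (c j <= t)) wgt B (c j) =
          \sum_(j in [set j | c j == t.+1]%SET) B ^ t.
  by apply: eq_big => [j|j cj]; rewrite ?inE; [lia|have -> : c j = t.+1 by lia].
rewrite sum_nat_const addnC divnMDl ?expn_gt0 // divn_small ?addn0 //.
exact: code_low_lt.
Qed.

Lemma code_dec j k : code (dec c j k) = code c - wgt B (c j) + wgt B (c j - k).
Proof.
rewrite /code [in RHS](bigD1 j) //= addKn (bigD1 j) //= /dec eqxx addnC.
by congr (_ + _); apply: eq_bigr => x /negPf ->.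
Qed.

Lemma wgt_le_code j : wgt B (c j) <= code c.
Proof. by rewrite /code (bigD1 j) //= leq_addr. Qed.
End Code.

(* [layer_sum] is what one pass of the decoding loop adds to the accumulator:
   the digits of [x] in base [B] are the multiplicities of the column sums. *)
Definition layer_sum B rho (G : nat -> nat) base k x :=
  \sum_(t < rho) (x %% B ^ t.+1 %/ B ^ t) *
    (if k <= t.+1 then G (base - B ^ t + wgt B (t.+1 - k)) else 0).

(* Horner scheme for [\sum_(k <= q) (q - 1)! / (q - k)! * layer_sum k]: the layer
   [k] steps back carries a factor [(q - k)!], so that no division is needed. *)
Fixpoint cell_acc B rho S (G : nat -> nat) pos q x d :=
  if d is e.+1 then cell_acc B rho S G pos q x e * e +
    layer_sum B rho G (pos - S * (q - e)) (q - e) x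
  else 0.

(** Columns of equal sum lead to the same new code, so the sum over columns is grouped by value and
    weighted by the digits. Since [0 < k], the columns of sum 0, which have no digit, contribute
    nothing. *)
Lemma layer_sum_code n rho (c : 'I_n -> nat) G base k :
  0 < k -> (forall j, c j <= rho) ->
  layer_sum n.+1 rho G (base + code c) k (code c) =
  \sum_j (if k <= c j then G (base + code (dec c j k)) else 0).
Proof.
move=> k0 c_le; rewrite /layer_sum.
rewrite [RHS](bigID (fun j => 0 < c j)) /= [X in _ = _ + X]big1 ?addn0; last first.
  move=> j cj; have -> : c j = 0 by lia.
  by rewrite leqNgt k0.
case: rho c_le => [|rho'] c_le.
  rewrite big_ord0 big1 // => j cj; have := c_le j; lia.
rewrite (partition_big (fun j => inord (c j).-1 : 'I_rho'.+1) predT) //=.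
apply: eq_bigr => t _; rewrite code_digit -sum_nat_const.
apply: eq_big => [j|j]; rewrite inE.
  apply/eqP/andP => [->|[cj /eqP <-]].
    by split => //; rewrite -val_eqE /= inordK.
  by rewrite inordK; have := c_le j; lia.
move=> /eqP cj; rewrite cj; case: ifP => // _; congr G.
by rewrite code_dec cj addnA addnBA //; have := wgt_le_code c j; rewrite cj.
Qed.

Section CellValue.
Variables (m n rho : nat) (r : 'I_m -> nat).

(* The row sums when the rows after [i] are complete, row [i] has received [q]
   units and the rows before it none. *)
Definition part (i : 'I_m) q : 'I_m -> nat :=
  fun x => if x == i then q else if i < x then r x else 0.

Lemma dec_part i q k : dec (part i q) i k = part i (q - k).
Proof. by apply/funext => x; rewrite /dec /part; case: eqP. Qed.

Variables (i : 'I_m) (den S L q : nat) (G : nat -> nat).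

(** The stored count carries the factor [den], meant for the factorials of the completed rows, and
    [q'!] for the current one. Only indices that code an actual column vector are constrained. *)
Definition good_layer q' := forall c : 'I_n -> nat, (forall j, c j <= rho) ->
  G ((L + q') * S + code c) = den * q'`! * num_ctables (part i q') c.

(** Multiplying the recurrence [q T_q = sum_k sum_j T_(q-k)] by [(q - 1)!] gives [q! T_q]. The
    earlier layers already hold [(q - k)! T_(q-k)], so the missing factors are integers. *)
Lemma cell_acc_code (c : 'I_n -> nat) :
  0 < q -> (forall j, c j <= rho) -> (forall q', q' < q -> good_layer q') ->
  cell_acc n.+1 rho S G ((L + q) * S + code c) q (code c) q =
  den * q`! * num_ctables (part i q) c.
Proof.
move=> q0 c_le good.
pose s k := \sum_j (if k <= c j then num_ctables (part i (q - k)) (dec c j k) else 0).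
have dec_le j k x : dec c j k x <= rho.
  by rewrite /dec; case: eqP => // _; exact: leq_trans (leq_subr _ _) (c_le x).
(* After [d] passes the moves of [k > q - d] units are included, all brought to the common factor
   [(d - 1)!]. *)
have accE d : 0 < d <= q ->
    cell_acc n.+1 rho S G ((L + q) * S + code c) q (code c) d =
    den * (d.-1)`! * \sum_((q - d).+1 <= k < q.+1) s k.
  elim: d => [//|d IHd] /andP[_ dq] /=.
  have -> : (L + q) * S + code c - S * (q - d) = (L + d) * S + code c.
    have -> : L + q = L + d + (q - d) by lia.
    by rewrite mulnDl [S * _]mulnC; lia.
  rewrite layer_sum_code //; last by rewrite subn_gt0.
  rewrite (eq_bigr (fun j => den * d`! * (if q - d <= c j then
      num_ctables (part i (q - (q - d))) (dec c j (q - d)) else 0))); last first.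
    move=> j _; case: ifP => [_|]; last by rewrite muln0.
    by rewrite good // subKn // ltnW.
  rewrite -big_distrr /= -/(s (q - d)).
  have -> : (q - d.+1).+1 = q - d by lia.
  rewrite [in RHS]big_ltn; last by lia.
  case: d IHd dq => [|d] IHd dq.
    by rewrite muln0 add0n subn0 big_geq // addn0.
  rewrite IHd ?(ltnW dq) // mulnDr [in RHS]addnC; congr (_ + _).
  by rewrite factS /=; ring.
rewrite accE ?q0 ?leqnn // subnn -mulnA -[in RHS]mulnA; congr (_ * _).
rewrite -[in RHS](prednK q0) factS prednK // -mulnA mulnCA; congr (_ * _).
have partq : part i q i = q by rewrite /part eqxx.
have := num_ctables_newton (part i q) c i; rewrite partq => ->.
rewrite big_add1 /= big_mkord; apply: eq_bigr => k _.
by apply: eq_bigr => j _; rewrite dec_part.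
Qed.
End CellValue.

(** * Weakest preconditions with a time bound *)

(** The final state is chosen before [rest] and [w], and [w] is returned intact: the predicate is
    meant for programs that toss no coin, and it composes under any continuation. *)
Definition wp (p : cmd) (Q : (nat -> nat) -> (nat -> nat -> nat) -> Prop) T v h :=
  exists t v' h', [/\ t <= T, Q v' h' &
    forall rest w, iter t step (Config (p :: rest) v h w) = Config rest v' h' w].

Section Rules.
Implicit Types (v : nat -> nat) (h : nat -> nat -> nat).
Implicit Types (Q : (nat -> nat) -> (nat -> nat -> nat) -> Prop).

Lemma wp_weaken p Q Q' T T' v h : wp p Q T v h -> T <= T' ->
  (forall v' h', Q v' h' -> Q' v' h') -> wp p Q' T' v h.
Proof.
move=> [t [v' [h' [tT Qv E]]]] TT' QQ'; exists t, v', h'.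
by split=> //; [exact: leq_trans TT' | exact: QQ'].
Qed.

Lemma wp_time p Q T T' v h : T <= T' -> wp p Q T v h -> wp p Q T' v h.
Proof. by move=> TT' pQ; apply: wp_weaken pQ TT' _. Qed.

Lemma wp_step1 p Q v h v' h' :
  (forall rest w, step (Config (p :: rest) v h w) = Config rest v' h' w) ->
  Q v' h' -> wp p Q 1 v h.
Proof. by move=> E Qv; exists 1, v', h'. Qed.

Lemma wp_skip Q v h : Q v h -> wp Skip Q 1 v h.
Proof. exact: wp_step1. Qed.
Lemma wp_const Q x k v h : Q (upd v x k) h -> wp (Const x k) Q 1 v h.
Proof. exact: wp_step1. Qed.
Lemma wp_add Q x y z v h : Q (upd v x (v y + v z)) h -> wp (Add x y z) Q 1 v h.
Proof. exact: wp_step1. Qed.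
Lemma wp_sub Q x y z v h : Q (upd v x (v y - v z)) h -> wp (Defs.Sub x y z) Q 1 v h.
Proof. exact: wp_step1. Qed.
Lemma wp_get Q x a y v h : Q (upd v x (h a (v y))) h -> wp (Get x a y) Q 1 v h.
Proof. exact: wp_step1. Qed.
Lemma wp_put Q a x y v h :
  Q v (upd h a (upd (h a) (v x) (v y))) -> wp (Put a x y) Q 1 v h.
Proof. exact: wp_step1. Qed.

Lemma wp_seq p q Q T1 T2 v h :
  wp p (fun v' h' => wp q Q T2 v' h') T1 v h -> wp (Seq p q) Q (T1 + T2).+1 v h.
Proof.
move=> [t1 [v1 [h1 [tT1 [t2 [v2 [h2 [tT2 Qv E2]]]] E1]]]].
exists (t2 + t1).+1, v2, h2; split=> //; first by lia.
by move=> rest w; rewrite iterSr iterD /= E1 E2.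
Qed.

Lemma wp_if x p q Q T v h : (v x != 0 -> wp p Q T v h) ->
  (v x = 0 -> wp q Q T v h) -> wp (If x p q) Q T.+1 v h.
Proof.
move=> P1 P2; have [vx|vx] := eqVneq (v x) 0.
  have [t [v' [h' [tT Qv E]]]] := P2 vx; exists t.+1, v', h'; split=> // rest w.
  by rewrite iterSr /= vx /= E.
have [t [v' [h' [tT Qv E]]]] := P1 vx; exists t.+1, v', h'; split=> // rest w.
by rewrite iterSr /= (negPf vx) E.
Qed.

Lemma wp_while x p (I : nat -> (nat -> nat) -> (nat -> nat -> nat) -> Prop) Q T k v h :
  (forall k v h, I k.+1 v h -> v x != 0 /\ wp p (I k) T v h) ->
  (forall v h, I 0 v h -> v x = 0 /\ Q v h) ->
  I k v h -> wp (While x p) Q (k * T.+1).+1 v h.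
Proof.
move=> IS I0; elim: k v h => [|k IHk] v h Ik.
  have [vx Qv] := I0 _ _ Ik; exists 1, v, h; split=> // rest w.
  by rewrite /= vx.
have [vx [t1 [v1 [h1 [tT1 I1 E1]]]]] := IS _ _ _ Ik.
have [t2 [v2 [h2 [tT2 Qv E2]]]] := IHk _ _ I1.
exists (t2 + t1).+1, v2, h2; split=> //; first by lia.
by move=> rest w; rewrite iterSr iterD /= (negPf vx) E1 E2.
Qed.

Definition ONE := 2.
Definition ZERO := 24.
Definition Down x body := While x (Seq body (Defs.Sub x x ONE)).

(** Here [k] counts the passes to come, and the body must establish the invariant for the state
    after the decrement made by [Down]. Beyond the body, a pass costs three steps: the loop test,
    the unfolding of [Seq] and the subtraction. *)
Lemma wp_down x body (I : nat -> (nat -> nat) -> (nat -> nat -> nat) -> Prop) Q T k v h :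
  (forall k v h, v x = k.+1 -> I k.+1 v h ->
     wp body (fun v' h' => [/\ v' x = k.+1, v' ONE = 1 & I k (upd v' x k) h']) T v h) ->
  (forall v h, v x = 0 -> I 0 v h -> Q v h) ->
  v x = k -> I k v h -> wp (Down x body) Q (k * T.+3).+1 v h.
Proof.
move=> IS I0 vx Ik; rewrite /Down (_ : T.+3 = (T + 1).+2); last by rewrite addn1.
apply: (wp_while (I := fun k v h => v x = k /\ I k v h)) => // [|v' h' [vx' Iv]];
  last by split=> //; exact: I0.
move=> {vx Ik}k {}v {}h [vx Ik]; split; first by rewrite vx.
apply: wp_seq; apply: wp_weaken (IS _ _ _ vx Ik) _ _ => // v' h' [vx' one I'].
apply: wp_sub; rewrite vx' one subn1 /=; split=> //.
by rewrite /upd eqxx.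
Qed.

Definition U := 22.
(** Repeated addition takes time linear in the value of [b]; all calls therefore place the small
    factor, at most [rho] or equal to [n + 1], last. *)
Definition Mul d a b := Seq (Const d 0) (Seq (Add U b ZERO) (Down U (Add d d a))).

Definition frame (s : seq nat) (v v' : nat -> nat) := forall y, y \notin s -> v' y = v y.

Lemma wp_mul d a b v h : v ONE = 1 -> v ZERO = 0 ->
  [&& d != a, d != U, d != ONE, d != ZERO & [&& a != U, b != d & b != U]] ->
  wp (Mul d a b) (fun v' h' =>
    [/\ v' d = v a * v b, frame [:: d; U] v v' & h' = h]) (v b * 4 + 5) v h.
Proof.
move=> v1 v0 /and5P[da dU d1 d0 /and3P[aU bd bU]].
apply: (@wp_time _ _ (1 + (1 + (v b * 4).+1).+1).+1); first by lia.
apply: wp_seq; apply: wp_const; apply: wp_seq; apply: wp_add.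
apply: (wp_down (I := fun k v' h' => [/\ v' d + v a * k = v a * v b,
  frame [:: d; U] v v' & h' = h])).
- move=> k v' h' vU [vd fr ->]; apply: wp_add; split.
  + by rewrite /upd eq_sym (negPf dU).
  + by rewrite /upd eq_sym (negPf d1) fr // !inE negb_or eq_sym d1.
  split=> //.
    rewrite /upd eqxx (negPf dU) (fr a) ?inE ?negb_or 1?eq_sym ?da ?aU //; lia.
  move=> y; rewrite !inE negb_or /upd => /andP[yd yU].
  by rewrite (negPf yd) (negPf yU) fr // !inE negb_or yd.
- by move=> v' h' _ [vd fr ->]; split=> //; rewrite -vd muln0 addn0.
- by rewrite /upd eqxx (negPf bd) eq_sym (negPf d0) v0 addn0.
split=> //.
  by rewrite /upd (negPf dU) eqxx.
by move=> y; rewrite !inE negb_or /upd => /andP[/negPf -> /negPf ->].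
Qed.
End Rules.

(** * The counting program *)

Lemma wp_bind p Q R T v h : wp p R T v h ->
  (forall v' h', R v' h' -> Q v' h') -> wp p Q T v h.
Proof. by move=> pR RQ; apply: wp_weaken pR _ RQ. Qed.

Lemma frame_trans s v1 v2 v3 : frame s v1 v2 -> frame s v2 v3 -> frame s v1 v3.
Proof. by move=> f g y ys; rewrite g ?f. Qed.

Lemma frame_sub s s' v v' : all [in s'] s -> frame s v v' -> frame s' v v'.
Proof. by move=> /allP ss' f y ys; apply: f; apply: contra ys => /ss'. Qed.

Lemma frame_upd s v v' y k : y \in s -> frame s v v' -> frame s v (upd v' y k).
Proof.
move=> ys f z zs; rewrite /upd; case: eqP => [zy|_]; last exact: f.
by rewrite zy ys in zs.
Qed.

(* Array 2 holds the weights [wgt B], array 3 the table of the dynamic program: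
   cell [l * S + code c] is filled once the first [l] units of the rows, taken
   from the last row to the first, have been processed. Register [ZERO] is never
   written and keeps its initial value 0. *)
Local Notation rB := 3.  (* n + 1 *)
Local Notation rS := 4.  (* number of codes *)
Local Notation rP := 5.  (* next cell of array 3 *)
Local Notation rDEN := 6.  (* denominator *)
Local Notation rI := 7.
Local Notation rY := 8.
Local Notation rQ := 9.  (* current residual of the row *)
Local Notation rE := 10.
Local Notation rX := 11.  (* current code *)
Local Notation rK := 12.  (* number of units moved *)
Local Notation rACC := 13.
Local Notation rBASE := 14.  (* cell of code rX, rK layers back *)
Local Notation rREM := 15.
Local Notation rT := 16.
Local Notation rWT := 17.
Local Notation rCOND := 18.
Local Notation rD := 19.
Local Notation rIDX := 20.
Local Notation rTMP := 21.
Local Notation rVAL := 23.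

Definition decode_add :=
  Seq (Defs.Sub rD rT rK) (Seq (Get rD 2 rD) (Seq (Defs.Sub rIDX rBASE rWT)
  (Seq (Add rIDX rIDX rD) (Seq (Get rVAL 3 rIDX) (Add rACC rACC rVAL))))).

(** Digits are extracted by repeated subtraction: each pass removes one weight and handles one
    column of sum [rT]. The tests [rK <= rT] and [rWT <= rREM] are truncated subtractions with 1
    added, nonzero exactly when the inequality holds. *)
Definition decode_body :=
  Seq (Defs.Sub rREM rREM rWT) (Seq (Add rD rT ONE) (Seq (Defs.Sub rD rD rK)
  (Seq (If rD decode_add Skip)
  (Seq (Add rCOND rREM ONE) (Defs.Sub rCOND rCOND rWT))))).

Definition decode_digit :=
  Seq (Get rWT 2 rT) (Seq (Add rCOND rREM ONE) (Seq (Defs.Sub rCOND rCOND rWT)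
  (While rCOND decode_body))).

Definition decode rho :=
  Seq (Add rREM rX ZERO) (Seq (Const rT rho) (Down rT decode_digit)).

Definition body_regs := [:: rACC; rREM; rCOND; rD; rIDX; rVAL].
Definition decode_regs := rWT :: body_regs.

Local Ltac frame_tac :=
  let y := fresh "y" in
  move=> y; rewrite /decode_regs /body_regs !inE !negb_or /upd;
  repeat (case: eqP => [->|_] //=).

Lemma wp_decode_body v h : v ONE = 1 ->
  wp decode_body (fun v' h' => [/\
     v' rREM = v rREM - v rWT,
     v' rACC = v rACC + (if v rK <= v rT then
        h 3 (v rBASE - v rWT + h 2 (v rT - v rK)) else 0),
     v' rCOND = v' rREM + 1 - v rWT,
     frame body_regs v v' & h' = h]) 22 v h.
Proof.
move=> v1; apply: wp_time; last first.
  apply: wp_seq; apply: wp_sub; apply: wp_seq; apply: wp_add; apply: wp_seq; apply: wp_sub.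
  apply: wp_seq; apply: wp_if; rewrite /upd /= v1.
    move=> kt; do 5![apply: wp_seq; first [apply: wp_sub | apply: wp_get | apply: wp_add]].
    apply: wp_add; apply: wp_seq; apply: wp_add; apply: wp_sub.
    rewrite /upd /= v1; have -> : v rK <= v rT by lia.
    by split=> //; frame_tac.
  move=> kt; apply: (@wp_time _ _ 1); last first.
    apply: wp_skip; apply: wp_seq; apply: wp_add; apply: wp_sub; rewrite /upd /= v1.
    have -> : v rK <= v rT = false by lia.
    by rewrite addn0; split=> //; frame_tac.
  by [].
by [].
Qed.
Lemma wp_decode_digit B v h : v ONE = 1 -> 0 < h 2 (v rT) ->
  v rREM < B * h 2 (v rT) ->
  wp decode_digit (fun v' h' => [/\
     v' rREM = v rREM %% h 2 (v rT),
     v' rACC = v rACC + v rREM %/ h 2 (v rT) * (if v rK <= v rT then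
        h 3 (v rBASE - h 2 (v rT) + h 2 (v rT - v rK)) else 0),
     frame decode_regs v v' & h' = h]) (B * 23 + 7) v h.
Proof.
set W := h 2 (v rT); set term := if _ then _ else 0 => v1 W0 remB.
apply: (@wp_time _ _ ((1 + (1 + (1 + (v rREM %/ W * 23).+1).+1).+1).+1)).
  have : v rREM %/ W <= B by rewrite ltnW // ltn_divLR.
  by lia.
apply: wp_seq; apply: wp_get; apply: wp_seq; apply: wp_add; apply: wp_seq; apply: wp_sub.
pose I k (v' : nat -> nat) h' := [/\ v' rREM = v rREM %% W + k * W,
  v' rACC + k * term = v rACC + v rREM %/ W * term,
  v' rCOND = v' rREM + 1 - W, v' rWT = W & frame decode_regs v v' /\ h' = h].
apply: (wp_while (I := I)).
- move=> k v' h' [remE accE condE wtE [fr ->]]; split.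
    by rewrite condE remE mulSn; lia.
  have v'1 : v' ONE = 1 by rewrite fr.
  apply: wp_bind (wp_decode_body h v'1) _ => v2 h2 [rem2 acc2 cond2 fr2 ->].
  have [fT fK fB] : [/\ v' rT = v rT, v' rK = v rK & v' rBASE = v rBASE] by rewrite !fr.
  have wt2 : v2 rWT = W.
    by rewrite fr2.
  split=> //.
  + by rewrite rem2 wtE remE mulSn; lia.
  + by rewrite acc2 wtE fT fK fB -/term -accE mulSn; lia.
  + by rewrite cond2 wtE.
  + by split=> //; exact: frame_trans fr (frame_sub _ fr2).
- move=> v' h' [remE accE condE wtE [fr ->]].
  have remW : v' rREM < W by rewrite remE addn0 ltn_pmod.
  split; first by rewrite condE; lia.
  by split=> //; [rewrite remE addn0|rewrite -accE addn0].
split; rewrite /upd /= ?v1 -/W //.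
- by rewrite addnC -divn_eq.
- by split=> //; frame_tac.
Qed.

Lemma wp_decode rho B x v h : v ONE = 1 -> v ZERO = 0 -> v rX = x -> x < B ^ rho ->
  0 < B -> (forall t, t <= rho -> h 2 t = wgt B t) ->
  wp (decode rho) (fun v' h' => [/\
     v' rACC = v rACC + layer_sum B rho (h 3) (v rBASE) (v rK) x,
     frame (rT :: decode_regs) v v' & h' = h]) (rho * (B * 23 + 10) + 5) v h.
Proof.
move=> v1 v0 vx xB B0 h2; apply: (@wp_time _ _ ((1 + (1 + (rho * (B * 23 + 7).+3).+1).+1).+1)).
  by lia.
apply: wp_seq; apply: wp_add; apply: wp_seq; apply: wp_const.
pose k := v rK; pose base := v rBASE.
pose f t := x %% B ^ t.+1 %/ B ^ t *
  (if k <= t.+1 then h 3 (base - B ^ t + wgt B (t.+1 - k)) else 0).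
(* Digits are stripped from the highest down; those of index [t] and above are gone, and the
   accumulator still misses the terms with [u < t]. *)
pose I t (v' : nat -> nat) h' := [/\ t <= rho, v' rREM = x %% B ^ t,
  v' rACC + \sum_(u < t) f u = v rACC + \sum_(u < rho) f u &
  frame (rT :: decode_regs) v v' /\ h' = h].
apply: (wp_down (I := I)).
- move=> t v' h' vT [tr rem acc [fr ->]].
  have h2T : h 2 (v' rT) = B ^ t by rewrite vT h2.
  have v'1 : v' ONE = 1 by rewrite fr.
  have [fK fB] : v' rK = k /\ v' rBASE = base by rewrite !fr.
  apply: wp_bind (@wp_decode_digit B v' h v'1 _ _) _.
  + by rewrite h2T expn_gt0 B0.
  + by rewrite h2T rem -expnS ltn_pmod // expn_gt0 B0.
  move=> v2 h3 [rem2 acc2 fr2 ->]; split; [by rewrite fr2|by rewrite fr2|].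
  split; first exact: ltnW.
  + by rewrite /upd /= rem2 h2T rem modn_dvdm // dvdn_exp2l.
  + rewrite /upd /= acc2 h2T vT fK fB -acc big_ord_recr /= -addnA; congr (_ + _).
    rewrite [RHS]addnC /f rem; congr (_ * _ + _).
    by case: ifP => // _; rewrite h2 // (leq_trans (leq_subr _ _)).
  + split=> //; apply: frame_upd; first by rewrite inE.
    by exact: frame_trans fr (frame_sub _ fr2).
- by move=> v' h' _ [_ rem acc [fr ->]]; split=> //; rewrite -acc big_ord0 addn0.
- by rewrite /upd.
split=> //; rewrite /upd /=.
- by rewrite vx v0 addn0 modn_small.
- by split=> //; frame_tac.
Qed.

Definition cell rho :=
  Seq (Const rACC 0) (Seq (Add rK rQ ZERO) (Down rK
  (Seq (Defs.Sub rD rQ rK) (Seq (Mul rTMP rACC rD) (Seq (Add rACC rTMP ZERO)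
  (Seq (Mul rD rS rK) (Seq (Defs.Sub rBASE rP rD) (decode rho)))))))).

Definition cell_regs := [:: rK; rBASE; rTMP; U; rT] ++ decode_regs.

Definition cell_time rho B := rho * (rho * (B * 23 + 10) + 8 * rho + 30) + 6.

Lemma wp_cell rho B q x v h : v ONE = 1 -> v ZERO = 0 -> v rX = x -> x < B ^ rho ->
  0 < B -> (forall t, t <= rho -> h 2 t = wgt B t) -> v rQ = q -> q <= rho ->
  wp (cell rho) (fun v' h' => [/\
     v' rACC = cell_acc B rho (v rS) (h 3) (v rP) q x q,
     frame cell_regs v v' & h' = h]) (cell_time rho B) v h.
Proof.
move=> v1 v0 vx xB B0 h2 vq qr.
apply: (@wp_time _ _ ((1 + (1 + (q * (rho * (B * 23 + 10) + 8 * rho + 27).+3).+1).+1).+1)).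
  have : q * (rho * (B * 23 + 10) + 8 * rho + 27).+3 <=
         rho * (rho * (B * 23 + 10) + 8 * rho + 27).+3 by rewrite leq_mul2r qr orbT.
  by rewrite /cell_time; lia.
apply: wp_seq; apply: wp_const; apply: wp_seq; apply: wp_add.
pose I k (v' : nat -> nat) h' := [/\ k <= q,
  v' rACC = cell_acc B rho (v rS) (h 3) (v rP) q x (q - k), frame cell_regs v v' & h' = h].
apply: (wp_down (I := I)).
- move=> k v' h' vk [kq acc fr ->].
  apply: (@wp_time _ _ (1 + ((rho * 4 + 5) + (1 + ((rho * 4 + 5) +
    (1 + (rho * (B * 23 + 10) + 5)).+1).+1).+1).+1).+1).
    by lia.
  apply: wp_seq; apply: wp_sub; apply: wp_seq.
  set va := upd v' _ _.
  have vaD : va rD = q - k.+1 by rewrite /va /upd /= vk fr // vq.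
  have va_1 : va ONE = 1 by rewrite /va /upd /= fr.
  have va_0 : va ZERO = 0 by rewrite /va /upd /= fr.
  apply: wp_weaken (@wp_mul rTMP rACC rD va h va_1 va_0 erefl) _ _.
    by rewrite vaD; lia.
  move=> vb hb [tb frb ->]; apply: wp_seq; apply: wp_add; apply: wp_seq.
  set vc := upd vb _ _.
  have vcK : vc rK = k.+1 by rewrite /vc /upd /= frb.
  have vc_1 : vc ONE = 1 by rewrite /vc /upd /= frb.
  have vc_0 : vc ZERO = 0 by rewrite /vc /upd /= frb.
  apply: wp_weaken (@wp_mul rD rS rK vc h vc_1 vc_0 erefl) _ _.
    by rewrite vcK; lia.
  move=> vd hd [td frd ->]; apply: wp_seq; apply: wp_sub.
  set ve := upd vd _ _.
  have fre : frame cell_regs v ve.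
    apply: frame_upd => //; apply: frame_trans (frame_sub _ frd) => //.
    apply: frame_upd => //; apply: frame_trans (frame_sub _ frb) => //.
    exact: frame_upd.
  have veacc : ve rACC = cell_acc B rho (v rS) (h 3) (v rP) q x (q - k.+1) * (q - k.+1).
    rewrite /ve /upd /= frd // /vc /upd /= tb frb // vaD va_0 addn0.
    by rewrite /va /upd /= acc.
  have veK : ve rK = k.+1 by rewrite /ve /upd /= frd.
  have veB : ve rBASE = v rP - v rS * k.+1.
    rewrite /ve /upd /= td vcK frd // /vc /upd /= !frb // /va /upd /= !fr //.
  apply: wp_bind (@wp_decode rho B x ve h _ _ _ xB B0 h2) _.
  + by rewrite fre.
  + by rewrite fre.
  + by rewrite fre.
  move=> vf hf [accf frf ->].
  have frf' : frame cell_regs v vf.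
    exact: frame_trans fre (frame_sub _ frf).
  split; [by rewrite frf|by rewrite frf'|].
  split; first exact: ltnW.
  + rewrite /upd /= accf veacc veK veB -[q - k]subSS subSn //= subKn //.
  + exact: frame_upd.
  + by [].
- by move=> v' h' _ [_ acc fr ->]; rewrite subn0 in acc.
- by rewrite /upd /= vq v0 addn0.
split=> //; first by rewrite subnn /upd.
by rewrite /cell_regs; frame_tac.
Qed.

Definition layer rho :=
  Down rE (Seq (cell rho) (Seq (Put 3 rP rACC) (Seq (Add rP rP ONE) (Add rX rX ONE)))).

Definition layer_regs := [:: rE; rP; rX; rACC] ++ cell_regs.

Section Layer.
Variables (m n rho : nat) (r : 'I_m -> nat).
Local Notation B := n.+1.
Local Notation S := (B ^ rho).

Definition same_arrays (h h' : nat -> nat -> nat) := forall a, a != 3 -> h' a = h a.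

(** [L] counts the units of the rows after [i], so that layer [L + q'] is the one where row [i] has
    received [q'] units. *)
Definition good_below (i : 'I_m) den L q (h : nat -> nat -> nat) :=
  forall q', q' < q -> good_layer n rho r i den S L (h 3) q'.

Lemma good_layer_agree (i : 'I_m) den L q G G' :
  good_layer n rho r i den S L G q ->
  (forall y, y < (L + q).+1 * S -> G' y = G y) ->
  good_layer n rho r i den S L G' q.
Proof.
move=> good GG c c_le; rewrite GG ?good //.
by have := code_lt c_le; rewrite mulSn addnC ltn_add2r.
Qed.

(** A relevant cell depends only on strictly earlier layers, which the writing of the current layer
    leaves intact. All [S] indices are filled, but nothing is claimed about those that code no
    column vector. *)
Lemma wp_layer (i : 'I_m) den L q v h :
  v ONE = 1 -> v ZERO = 0 -> v rX = 0 -> v rE = S -> v rS = S ->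
  (forall t, t <= rho -> h 2 t = wgt B t) -> v rQ = q -> 0 < q <= rho ->
  v rP = (L + q) * S -> good_below i den L q h ->
  wp (layer rho) (fun v' h' => [/\ v' rP = (L + q.+1) * S,
     frame layer_regs v v', same_arrays h h' & good_below i den L q.+1 h'])
   (S * (cell_time rho B + 9)).+1 v h.
Proof.
move=> v1 v0 vX vE vS h2 vq /andP[q0 qr] vP good.
pose start := (L + q) * S.
apply: (@wp_time _ _ (S * ((cell_time rho B + (1 + (1 + 1).+1).+1).+1).+3).+1).
  by rewrite ltnS leq_mul2l; apply/orP; right; lia.
pose I e (v' : nat -> nat) h' := [/\ e <= S, v' rX = S - e, v' rP = start + (S - e),
  frame layer_regs v v' & [/\ same_arrays h h', (forall y, y < start -> h' 3 y = h 3 y) &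
  forall c : 'I_n -> nat, (forall j, c j <= rho) -> code c < S - e ->
    h' 3 (start + code c) = den * q`! * num_ctables (part r i q) c]].
apply: (wp_down (I := I)) => //.
- move=> e v' h' vE' [eS vX' vP' fr [same low done]].
  have [v'1 v'0 v'S v'Q] : [/\ v' ONE = 1, v' ZERO = 0, v' rS = S & v' rQ = q].
    by rewrite !fr.
  have h'2 t : t <= rho -> h' 2 t = wgt B t by move=> tr; rewrite same // h2.
  have xS : S - e.+1 < S by rewrite ltn_subrL expn_gt0.
  apply: wp_seq.
  apply: wp_bind (@wp_cell rho B q (S - e.+1) v' h' v'1 v'0 vX' xS isT h'2 v'Q qr) _.
  move=> v2 h3 [acc fr2 ->]; have v2P : v2 rP = start + (S - e.+1) by rewrite fr2.
  apply: wp_seq; apply: wp_put; apply: wp_seq; apply: wp_add.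
  apply: wp_add; split; [by rewrite /upd /= fr2|by rewrite /upd /= fr2|].
  split.
  + exact: ltnW.
  + by rewrite /upd /= !fr2 // v'1 vX'; lia.
  + by rewrite /upd /= !fr2 // v'1 vP'; lia.
  + do 3![apply: frame_upd => //]; exact: frame_trans fr (frame_sub _ fr2).
  split.
  + by move=> a a3; rewrite {1}/upd (negPf a3) same.
  + by move=> y ys; rewrite /upd eqxx v2P ltn_eqF ?low // (leq_trans ys) // leq_addr.
  + move=> c c_le cS; rewrite /upd eqxx v2P eqn_add2l.
    case: eqP => [cx|cx]; last by apply: done => //; lia.
    rewrite acc v'S vP' -cx; apply: cell_acc_code => // q' q'q c' c'_le.
    rewrite low; first by apply: good.
    have := code_lt c'_le => c'S; apply: (@leq_trans ((L + q').+1 * S)).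
      by rewrite mulSn addnC ltn_add2r.
    by rewrite /start leq_mul2r; apply/orP; right; lia.
- move=> v' h' _ [_ vX' vP' fr [same low done]]; split=> //.
    by rewrite vP' subn0 /start addnS mulSn addnC.
  move=> q'; rewrite ltnS leq_eqVlt => /predU1P[->|q'q].
    by move=> c c_le; rewrite done // subn0 code_lt.
  apply: good_layer_agree (good _ q'q) _ => y yS; apply: low.
  by apply: leq_trans yS _; rewrite leq_mul2r; apply/orP; right; lia.
split=> //; rewrite ?subnn // ?addn0 //.
Qed.

Definition row_body rho :=
  Seq (Defs.Sub rTMP rI ONE) (Seq (Get rY 0 rTMP) (Seq (Const rQ 0)
  (Down rY (Seq (Add rQ rQ ONE) (Seq (Mul rACC rDEN rQ) (Seq (Add rDEN rACC ZERO)
    (Seq (Const rX 0) (Seq (Add rE rS ZERO) (layer rho))))))))).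

Definition row_regs := [:: rTMP; rY; rQ; rDEN; U] ++ layer_regs.

Definition row_time := rho * ((S * (cell_time rho B + 9)) + 4 * rho + 30) + 20.

(** The layer of residual 0 is the last one of the rows already treated, which is why [good_below]
    is assumed at 1. Pass [q] multiplies the denominator by [q], whence the final factor
    [(r i)!]. *)
Lemma wp_row (i : 'I_m) den L v h :
  v ONE = 1 -> v ZERO = 0 -> v rS = S -> v rI = i.+1 ->
  (forall t, t <= rho -> h 2 t = wgt B t) -> h 0 i = r i -> r i <= rho ->
  v rP = L.+1 * S -> v rDEN = den -> good_below i den L 1 h ->
  wp (row_body rho) (fun v' h' => [/\ v' rP = (L + r i).+1 * S,
     v' rDEN = den * (r i)`!, frame row_regs v v', same_arrays h h' &
     good_below i den L (r i).+1 h']) row_time v h.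
Proof.
move=> v1 v0 vS vI h2 h0i ri_le vP vD good.
apply: (@wp_time _ _ (1 + (1 + (1 + (r i * ((1 + ((4 * rho + 5) + (1 + (1 + (1 +
   (S * (cell_time rho B + 9)).+1).+1).+1).+1).+1).+1).+3).+1).+1).+1).+1).
  rewrite /row_time; set X := S * _.
  have : r i * (1 + (4 * rho + 5 + (1 + (1 + (1 + X.+1).+1).+1).+1).+1).+4 <=
      rho * (1 + (4 * rho + 5 + (1 + (1 + (1 + X.+1).+1).+1).+1).+1).+4.
    by rewrite leq_mul2r ri_le orbT.
  by lia.
apply: wp_seq; apply: wp_sub; apply: wp_seq; apply: wp_get; apply: wp_seq; apply: wp_const.
pose I y (v' : nat -> nat) h' := [/\ y <= r i, v' rQ = r i - y,
  v' rP = (L + (r i - y)).+1 * S, v' rDEN = den * (r i - y)`! &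
  [/\ frame row_regs v v', same_arrays h h' & good_below i den L (r i - y).+1 h']].
apply: (wp_down (I := I)).
- move=> y v' h' vY [yr vQ vP' vD' [fr same good']].
  have [v'1 v'0 v'S] : [/\ v' ONE = 1, v' ZERO = 0 & v' rS = S] by rewrite !fr.
  have ry : r i - y = (r i - y.+1).+1 by lia.
  apply: wp_seq; apply: wp_add; apply: wp_seq.
  set va := upd v' _ _.
  have va_1 : va ONE = 1 by rewrite /va /upd.
  have va_0 : va ZERO = 0 by rewrite /va /upd.
  have vaQ : va rQ = r i - y by rewrite /va /upd /= vQ v'1; lia.
  apply: wp_weaken (@wp_mul rACC rDEN rQ va h' va_1 va_0 erefl) _ _.
    by rewrite vaQ; lia.
  move=> vb hb [acc frb ->]; apply: wp_seq; apply: wp_add; apply: wp_seq; apply: wp_const.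
  apply: wp_seq; apply: wp_add.
  set vc := upd _ rE _.
  have fra : frame row_regs v va by apply: frame_upd.
  have frb' : frame row_regs v vb by apply: frame_trans fra (frame_sub _ frb).
  have frc : frame row_regs v vc by do 3![apply: frame_upd => //].
  have vcP : vc rP = (L + (r i - y)) * S.
    by rewrite /vc /upd /= frb // /va /upd /= vP' ry addnS.
  have vcD : vc rDEN = den * (r i - y)`!.
    rewrite /vc /upd /= acc vaQ frb // va_0 addn0 /va /upd /= vD' ry factS.
    by rewrite -mulnA [_ * _.+1]mulnC.
  have vcQ : vc rQ = r i - y by rewrite /vc /upd /= frb.
  have qr : 0 < r i - y <= rho by lia.
  have [vc_1 vc_0] : vc ONE = 1 /\ vc ZERO = 0 by rewrite !frc.
  have vcS : vc rS = S by rewrite frc.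
  have vcE : vc rE = S by rewrite /vc /upd /= !frb // va_0 addn0 /va /upd.
  have h'2 t : t <= rho -> h' 2 t = wgt B t by move=> tr; rewrite same // h2.
  have good'' : good_below i den L (r i - y) h' by rewrite ry.
  apply: wp_bind (@wp_layer i den L _ vc h' vc_1 vc_0 erefl vcE vcS h'2 vcQ qr vcP good'') _.
  move=> vd hd [vdP frd same' gd].
  have vdE k : k \notin layer_regs -> vd k = vc k := frd k.
  split; [|by rewrite vdE|].
    by rewrite vdE // /vc /upd /= frb // /va /upd.
  split; rewrite ?{1}/upd /=.
  + exact: ltnW.
  + by rewrite vdE.
  + by rewrite vdP addnS.
  + by rewrite vdE.
  split=> //.
  + by apply: frame_upd => //; exact: frame_trans frc (frame_sub _ frd).
  + by move=> a a3; rewrite same' // same.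
- by move=> v' h' _ [_ _ vP' vD' [fr same gd]]; rewrite subn0 in vP' vD' gd; split.
- by rewrite /upd /= vI v1 subn1.
split=> //; rewrite ?subnn ?addn0 /upd //=.
  by rewrite fact0 muln1.
by split=> //; rewrite /row_regs /layer_regs /cell_regs; frame_tac.
Qed.
End Layer.

Definition weights :=
  Down rT (Seq (Add rX rX ONE) (Seq (Put 2 rX rS)
    (Seq (Mul rACC rS rB) (Add rS rACC ZERO)))).

Lemma wp_weights rho B v h : v ONE = 1 -> v ZERO = 0 -> v rB = B -> v rS = 1 ->
  v rX = 0 -> v rT = rho -> h 2 0 = 0 ->
  wp weights (fun v' h' => [/\ v' rS = B ^ rho,
    frame [:: rT; rX; rACC; U; rS] v v', forall a, a != 2 -> h' a = h a &
    forall t, t <= rho -> h' 2 t = wgt B t]) (rho * (B * 4 + 14)).+1 v h.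
Proof.
move=> v1 v0 vB vS vX vT h20.
pose I k (v' : nat -> nat) (h' : nat -> nat -> nat) := [/\ k <= rho,
  v' rS = B ^ (rho - k), v' rX = rho - k,
  frame [:: rT; rX; rACC; U; rS] v v' & (forall a, a != 2 -> h' a = h a) /\
    forall t, t <= rho - k -> h' 2 t = wgt B t].
apply: (@wp_time _ _ (rho * ((1 + (1 + (B * 4 + 5 + 1).+1).+1).+1).+3).+1).
  by rewrite ltnS leq_mul2l; apply/orP; right; lia.
apply: (wp_down (I := I)) => //.
- move=> k v' h' vT' [kr vS' vX' fr [same w]].
  apply: wp_seq; apply: wp_add; apply: wp_seq; apply: wp_put; apply: wp_seq.
  set va := upd v' _ _; set ha := upd h' _ _.
  have [v'1 v'0 v'B] : [/\ v' ONE = 1, v' ZERO = 0 & v' rB = B] by rewrite !fr.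
  have va_1 : va ONE = 1 by rewrite /va /upd.
  have va_0 : va ZERO = 0 by rewrite /va /upd.
  have vaB : va rB = B by rewrite /va /upd.
  apply: wp_weaken (@wp_mul rACC rS rB va ha va_1 va_0 erefl) _ _.
    by rewrite vaB.
  move=> vb hb [acc frb ->]; apply: wp_add.
  have vaX : va rX = rho - k by rewrite /va /upd /= vX' v'1; lia.
  have vaS : va rS = B ^ (rho - k.+1) by rewrite /va /upd.
  have rk : rho - k = (rho - k.+1).+1 by lia.
  split; [by rewrite /upd /= frb // /va /upd|by rewrite /upd /= frb // /va /upd|].
  split.
  + exact: ltnW.
  + by rewrite /upd /= acc vaS vaB frb // va_0 addn0 rk expnS mulnC.
  + by rewrite /upd /= frb.
  + do 2![apply: frame_upd => //]; apply: frame_trans (frame_sub _ frb) => //.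
    exact: frame_upd.
  split; first by move=> a a2; rewrite /ha /upd (negPf a2) same.
  move=> t tk; have -> : ha 2 t = if t == va rX then va rS else h' 2 t by [].
  rewrite vaX vaS; case: eqP => [->|tX]; first by rewrite rk.
  by apply: w; lia.
- by move=> v' h' _ [_ vS' _ fr [same w]]; rewrite subn0 in vS' w; split.
split; rewrite ?subnn // ?vX ?vS //.
by split=> // t; rewrite leqn0 => /eqP ->.
Qed.

Section Rows.
Variables (m n rho : nat) (r : 'I_m -> nat).
Local Notation B := n.+1.
Local Notation S := (B ^ rho).

Definition rows_time := m * (row_time n rho).+3 + 1.

Lemma wp_rows v h :
  v ONE = 1 -> v ZERO = 0 -> v rS = S -> v rI = m ->
  (forall t, t <= rho -> h 2 t = wgt B t) -> (forall i : 'I_m, h 0 i = r i) ->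
  (forall i, r i <= rho) ->
  v rP = S -> v rDEN = 1 -> (forall y, h 3 y = (y == 0)) ->
  wp (Down rI (row_body rho)) (fun v' h' => [/\ v' rP = (\sum_i r i).+1 * S,
    v' rDEN = \prod_i (r i)`!, frame (rI :: row_regs) v v', same_arrays h h' &
    forall c : 'I_n -> nat, (forall j, c j <= rho) ->
      h' 3 ((\sum_i r i) * S + code c) = \prod_i (r i)`! * num_ctables r c])
  rows_time v h.
Proof.
move=> v1 v0 vS vI h2 h0 r_le vP vD h3.
pose Lk k := \sum_(x < m | k <= x) r x.
pose Dk k := \prod_(x < m | k <= x) (r x)`!.
pose rk k (x : 'I_m) := if k <= x then r x else 0.
pose I k (v' : nat -> nat) (h' : nat -> nat -> nat) := [/\ k <= m,
  v' rP = (Lk k).+1 * S, v' rDEN = Dk k,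
  frame (rI :: row_regs) v v' & same_arrays h h' /\
    forall c : 'I_n -> nat, (forall j, c j <= rho) ->
      h' 3 (Lk k * S + code c) = Dk k * num_ctables (rk k) c].
rewrite /rows_time addn1; apply: (wp_down (I := I)) => //.
- move=> k v' h' vI' [km vP' vD' fr [same good]].
  have [v'1 v'0 v'S] : [/\ v' ONE = 1, v' ZERO = 0 & v' rS = S] by rewrite !fr.
  have h'2 t : t <= rho -> h' 2 t = wgt B t by move=> tr; rewrite same // h2.
  pose i := Ordinal km.
  have h'0 : h' 0 i = r i by rewrite same // h0.
  have LS : Lk k = Lk k.+1 + r i.
    rewrite /Lk (bigD1 i) //= addnC; congr (_ + _); apply: eq_bigl => x.
    by rewrite -val_eqE /=; lia.
  have DS : Dk k = Dk k.+1 * (r i)`!.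
    rewrite /Dk (bigD1 i) //= mulnC; congr (_ * _); apply: eq_bigl => x.
    by rewrite -val_eqE /=; lia.
  have good1 : good_below n rho r i (Dk k.+1) (Lk k.+1) 1 h'.
    move=> q'; rewrite ltnS leqn0 => /eqP -> c c_le.
    rewrite addn0 good // fact0 muln1; congr (_ * num_ctables _ _).
    apply/funext => x; rewrite /rk /part -val_eqE /=.
    by case: (ltngtP k x) => //= ->.
  apply: wp_bind (@wp_row m n rho r i _ _ v' h' v'1 v'0 v'S vI' h'2 h'0 (r_le i) vP' vD' good1) _.
  move=> v2 h3' [vP2 vD2 fr2 same2 good2]; split; [by rewrite fr2|by rewrite fr2|].
  split.
  + exact: ltnW.
  + by rewrite /upd /= vP2 LS.
  + by rewrite /upd /= vD2 DS.
  + by apply: frame_upd => //; apply: frame_trans fr (frame_sub _ fr2).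
  split=> [a a3|c c_le]; first by rewrite same2 // same.
  rewrite LS good2 // DS; congr (_ * num_ctables _ _).
  apply/funext => x; rewrite /rk /part -val_eqE /=.
  by case: (ltngtP k x) => // kx; congr r; apply: val_inj.
- move=> v' h' _ [_ vP' vD' fr [same good]].
  have L0 : Lk 0 = \sum_i r i by apply: eq_bigl => x; rewrite leq0n.
  have D0 : Dk 0 = \prod_i (r i)`! by apply: eq_bigl => x; rewrite leq0n.
  by rewrite L0 D0 in vP' vD' good; split.
have L0 : Lk m = 0 by rewrite /Lk big_pred0 // => x; rewrite leqNgt ltn_ord.
have D0 : Dk m = 1 by rewrite /Dk big_pred0 // => x; rewrite leqNgt ltn_ord.
split; rewrite ?L0 ?D0 ?mul1n //; split=> // c c_le.
(* Base layer: when all row sums are 0, the count is 1 exactly for zero column sums, that is, for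
   code 0, the only cell initialised to 1. *)
rewrite ?L0 ?D0 ?mul0n ?add0n ?mul1n h3.
have -> : rk m = fun=> 0 by apply/funext => x; rewrite /rk leqNgt ltn_ord.
rewrite num_ctables_row0; congr nat_of_bool; rewrite sum_nat_eq0.
apply: eq_forallb => j; rewrite /=; case: (c j) => // u.
by rewrite /= expn_eq0.
Qed.

Definition column_code :=
  Down rI (Seq (Defs.Sub rTMP rI ONE) (Seq (Get rD 1 rTMP)
    (Seq (Get rWT 2 rD) (Add rACC rACC rWT)))).

Lemma wp_column_code (c : 'I_n -> nat) v h :
  v ONE = 1 -> v rI = n -> v rACC = 0 ->
  (forall t, t <= rho -> h 2 t = wgt B t) -> (forall j : 'I_n, h 1 j = c j) ->
  (forall j, c j <= rho) ->
  wp column_code (fun v' h' => [/\ v' rACC = code c,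
    frame [:: rI; rTMP; rD; rWT; rACC] v v' & h' = h]) (n * 10 + 1) v h.
Proof.
move=> v1 vI vA h2 h1 c_le.
pose I k (v' : nat -> nat) (h' : nat -> nat -> nat) := [/\ k <= n,
  v' rACC = \sum_(j < n | k <= j) wgt B (c j),
  frame [:: rI; rTMP; rD; rWT; rACC] v v' & h' = h].
rewrite addn1; apply: (wp_down (I := I)) => //.
- move=> k v' h' vI' [kn acc fr ->].
  apply: (@wp_time _ _ (1 + (1 + (1 + 1).+1).+1).+1); first by [].
  do 3![apply: wp_seq; first [apply: wp_sub | apply: wp_get]]; apply: wp_add.
  have v'1 : v' ONE = 1 by rewrite fr.
  split; [by rewrite /upd|by rewrite /upd|].
  split.
  + exact: ltnW.
  + rewrite /upd /= vI' v'1 subn1 acc (h1 (Ordinal kn)) h2 // [RHS](bigD1 (Ordinal kn)) //=.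
    rewrite addnC; congr (_ + _); apply: eq_bigl => x; rewrite -val_eqE /=; lia.
  + by do 5![apply: frame_upd => //].
  + by [].
- move=> v' h' _ [_ acc fr ->]; split=> //; rewrite acc; exact: eq_bigl.
split=> //; rewrite vA big_pred0 // => x; by rewrite leqNgt ltn_ord.
Qed.
End Rows.

(** Registers 0 and 1 hold [m] and [n] and are overwritten only at the end. After the rows, [rP]
    points just past the last layer; subtracting [rS] returns to its start, and the code of [c]
    selects the answer. *)
Definition ctables_program rho :=
  Seq (Const ONE 1) (Seq (Add rB 1 ONE) (Seq (Const rS 1) (Seq (Const rX 0)
  (Seq (Const rT rho) (Seq weights (Seq (Const rX 0) (Seq (Put 3 rX ONE)
  (Seq (Add rP rS ZERO) (Seq (Const rDEN 1) (Seq (Add rI 0 ZERO)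
  (Seq (Down rI (row_body rho)) (Seq (Const rACC 0) (Seq (Add rI 1 ZERO)
  (Seq column_code (Seq (Defs.Sub rP rP rS) (Seq (Add rIDX rP rACC)
  (Seq (Get 0 3 rIDX) (Add 1 rDEN ZERO)))))))))))))))))).

Definition program_time m n rho :=
  rho * (n.+1 * 4 + 14) + rows_time m n rho + n * 10 + 40.

Lemma wp_ctables_program m n rho (r : 'I_m -> nat) (c : 'I_n -> nat) w :
  (forall i, r i <= rho) -> (forall j, c j <= rho) ->
  \sum_i r i = \sum_j c j ->
  wp (ctables_program rho) (fun v' h' =>
    v' 0 = \prod_i (r i)`! * num_ctables r c /\ v' 1 = \prod_i (r i)`!)
    (program_time m n rho) (reg (initial (ctables_program rho) r c w))
    (arr (initial (ctables_program rho) r c w)).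
Proof.
move=> r_le c_le rc; rewrite /initial /=.
set v := upd _ 0 m; set h := upd _ 0 _.
have h0 (i : 'I_m) : h 0 i = r i by rewrite /h /upd /= valK.
have h1 (j : 'I_n) : h 1 j = c j by rewrite /h /upd /= valK.
apply: wp_time; last first.
  do 5![apply: wp_seq; first [apply: wp_const | apply: wp_add]].
  set va := upd _ rT _; apply: wp_seq.
  apply: wp_bind (@wp_weights rho n.+1 va h erefl erefl _ erefl erefl erefl erefl) _.
    by rewrite /va /v /upd /= addn1.
  move=> vb hb [vbS frb sameb wb].
  apply: wp_seq; apply: wp_const; apply: wp_seq; apply: wp_put.
  do 3![apply: wp_seq; first [apply: wp_const | apply: wp_add]].
  set hc := upd hb _ _; set vc := upd _ rI _.
  have [vb1 vb0 vbm vbn] : [/\ vb ONE = 1, vb ZERO = 0, vb 0 = m & vb 1 = n].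
    by rewrite !frb.
  apply: wp_seq; apply: wp_bind (@wp_rows m n rho r vc hc _ _ _ _ _ _ r_le _ _ _) _.
  + by rewrite /vc /upd.
  + by rewrite /vc /upd.
  + by rewrite /vc /upd.
  + by rewrite /vc /upd /= vbm vb0 addn0.
  + by move=> t tr; rewrite /hc /upd /= wb.
  + by move=> i; rewrite /hc /upd /= sameb // h0.
  + by rewrite /vc /upd /= vbS vb0 addn0.
  + by rewrite /vc /upd.
  + move=> y; rewrite /hc /upd /= sameb // vb1 /h /upd /=.
    by case: y.
  move=> vd hd [vdP vdD frd samed goodd].
  have [vd1 vd0 vdn vdS] : [/\ vd ONE = 1, vd ZERO = 0, vd 1 = n & vd rS = n.+1 ^ rho].
    by rewrite !frd.
  apply: wp_seq; apply: wp_const; apply: wp_seq; apply: wp_add; apply: wp_seq.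
  apply: wp_bind (@wp_column_code n rho c _ hd _ _ _ _ _ c_le) _.
  + by rewrite /upd.
  + by rewrite /upd /= vdn vd0 addn0.
  + by rewrite /upd.
  + by move=> t tr; rewrite samed // /hc /upd /= wb.
  + by move=> j; rewrite samed // /hc /upd /= sameb // h1.
  move=> ve he [acce fre ->].
  do 3![apply: wp_seq; first [apply: wp_sub | apply: wp_add | apply: wp_get]].
  apply: wp_add.
  have [veP veS veD ve0] : [/\ ve rP = vd rP, ve rS = vd rS, ve rDEN = vd rDEN & ve ZERO = 0].
    by rewrite !fre.
  rewrite /upd /= acce veP veS veD ve0 vdP vdS vdD addn0 mulSn addKn.
  by rewrite goodd.
by rewrite /program_time; lia.
Qed.

Local Open Scope classical_set_scope.
Local Open Scope ring_scope.

(** * Polynomial running time and conclusion *)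

Definition polynomial_fun (f : nat -> nat) := exists q : {poly nat}, forall N, q.[N] = f N.

Lemma polynomial_fun_cst k : polynomial_fun (fun=> k).
Proof. by exists k%:P => N; rewrite hornerC. Qed.

Lemma polynomial_fun_id : polynomial_fun id.
Proof. by exists 'X => N; rewrite hornerX. Qed.

Lemma polynomial_fun_add f g : polynomial_fun f -> polynomial_fun g ->
  polynomial_fun (fun N => f N + g N)%N.
Proof. by move=> [p pf] [q qg]; exists (p + q) => N; rewrite hornerD pf qg. Qed.

Lemma polynomial_fun_succ f : polynomial_fun f -> polynomial_fun (fun N => (f N).+1).
Proof. by move=> [p pf]; exists (p + 1%:P) => N; rewrite hornerD hornerC pf; exact: addn1. Qed.

Lemma polynomial_fun_mul f g : polynomial_fun f -> polynomial_fun g ->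
  polynomial_fun (fun N => f N * g N)%N.
Proof. by move=> [p pf] [q qg]; exists (p * q) => N; rewrite hornerM pf qg. Qed.

Lemma polynomial_fun_exp f k : polynomial_fun f -> polynomial_fun (fun N => f N ^ k)%N.
Proof.
move=> pf; elim: k => [|k IHk]; first exact: polynomial_fun_cst 1%N.
by under eq_fun do rewrite expnS; exact: polynomial_fun_mul.
Qed.

Lemma polynomial_fun_program_time rho : polynomial_fun (fun N => program_time N N rho).
Proof.
rewrite /program_time /rows_time /row_time /cell_time.
by repeat first [exact: polynomial_fun_cst | exact: polynomial_fun_id
  | apply: polynomial_fun_add | apply: polynomial_fun_mul | apply: polynomial_fun_exp
  | apply: polynomial_fun_succ].
Qed.

Lemma program_time_mono m n N rho : (m <= N)%N -> (n <= N)%N ->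
  (program_time m n rho <= program_time N N rho)%N.
Proof.
move=> mN nN; have cellE : (cell_time rho n.+1 <= cell_time rho N.+1)%N.
  by rewrite /cell_time leq_add2r leq_mul2l !leq_add2r leq_mul2l leq_add2r leq_mul2r ltnS nN !orbT.
have rowE : (row_time n rho <= row_time N rho)%N.
  rewrite /row_time leq_add2r leq_mul2l; apply/orP; right; rewrite !leq_add2r.
  apply: leq_mul; last by rewrite leq_add2r.
  by have [->|rho0] := posnP rho; rewrite ?expn0 // leq_exp2r.
rewrite /program_time /rows_time !leq_add //.
- by rewrite leq_mul2l leq_add2r leq_mul2r ltnS nN !orbT.
- by apply: leq_mul => //; rewrite !ltnS.
by rewrite leq_mul2r nN orbT.
Qed.

Lemma iter_step_halted t s : halted s -> iter t step s = s.
Proof.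
case: s => td v h w /=; rewrite /halted /= => /nilP ->.
by elim: t => //= t ->.
Qed.

(** Positivity of the margins is what converts a time bound in [m] and [n] into one in [N]. *)
Lemma num_rows_le m N (r : 'I_m -> nat) :
  (forall i, 0 < r i)%N -> (\sum_i r i)%N = N -> (m <= N)%N.
Proof.
move=> r_gt0 <-; rewrite -[leqLHS]card_ord -sum1_card.
by apply: leq_sum => i _; exact: r_gt0.
Qed.

Theorem ctables_randomized_approximation (R : realType) (rho : nat) (p : R) :
  p <= 1 -> forall eps : R, 0 < eps ->
   exists (prog : cmd) (q : {poly nat}),
   forall (m n N : nat) (r : 'I_m -> nat) (c : 'I_n -> nat),
     (forall i, (0 < r i <= rho)%N) -> (forall j, (0 < c j <= rho)%N) ->
     (\sum_i r i)%N = N -> (\sum_j c j)%N = N ->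
     halts_within prog r c q.[N] /\
     p <= output_prob prog r c q.[N]
            [set x : R | approximates eps (num_ctables r c)%:R x].
Proof.
move=> p_le1 eps eps0; have [q qE] := polynomial_fun_program_time rho.
exists (ctables_program rho), q => m n N r c r_le c_le rN cN; rewrite qE.
set T := program_time N N rho.
have run w : exists v h, [/\
    iter T step (initial (ctables_program rho) r c w) = Config [::] v h w,
    v 0%N = (\prod_i (r i)`! * num_ctables r c)%N & v 1%N = (\prod_i (r i)`!)%N].
  have [|||t [v [h [tT [v0 v1] E]]]] := @wp_ctables_program m n rho r c w.
  - by move=> i; have /andP[] := r_le i.
  - by move=> j; have /andP[] := c_le j.
  - by rewrite rN.
  exists v, h; split=> //.
  have tT' : (t <= T)%N.
    apply: leq_trans tT _; apply: program_time_mono.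
      by apply: num_rows_le rN => i; have /andP[] := r_le i.
    by apply: num_rows_le cN => j; have /andP[] := c_le j.
  (* A halted configuration is stationary, so the steps left over up to the polynomial bound change
     nothing. *)
  by rewrite -(subnK tT') iterD [iter t _ _]E iter_step_halted.
split; first by move=> w; have [v [h [-> _ _]]] := run w.
(* The output is the exact count, so every sequence of coins is favourable and the probability is
   1. *)
rewrite /output_prob (_ : finset _ = [set: _]%SET); last first.
  apply/setP => w; rewrite !inE; have [v [h [E v0 v1]]] := run w.
  apply/mem_set; rewrite /= /approximates /output E /= v0 v1 natrM mulrAC.
  rewrite divff ?mul1r; last first.
    by rewrite pnatr_eq0 -lt0n; apply: prodn_gt0 => i; exact: fact_gt0.
  by rewrite subrr normr0 mulr_ge0 // ltW.
by rewrite cardsT card_tuple card_bool natrX divff // expf_neq0 // pnatr_eq0.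
Qed.

Theorem mainTheorem6 (R : realType) (rho : nat) (p : R)
    (rho_gt0 : (0 < rho)%N) (p_gt0 : 0 < p) (p_lt1 : p < 1) :
  (exists C : R, 0 < C /\
    forall (eps : R), 0 < eps ->
    forall (m n N : nat) (r : 'I_m -> nat) (c : 'I_n -> nat),
      (forall i, (0 < r i <= rho)%N) -> (forall j, (0 < c j <= rho)%N) ->
      (\sum_i r i)%N = N -> (\sum_j c j)%N = N ->
    forall (rb : 'I_N -> 'I_m) (cb : 'I_N -> 'I_n),
      splitting r rb -> splitting c cb ->
    forall M : nat, Posz M = Num.ceil (C * eps ^- 2) ->
    forall (d : measure_display) (Omega : measurableType d)
      (P : probability Omega R)
      (gamma : 'I_M -> 'I_m -> 'I_n -> {RV P >-> R}),
      (forall s i j, standard_exponential P (gamma s i j)) ->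
      mutually_independent P
        (fun k : 'I_M * 'I_m * 'I_n => gamma k.1.1 k.1.2 k.2 : Omega -> R) ->
    let A (w : Omega) (s : 'I_M) : 'M[R]_N :=
      block_mx_of rb cb (fun i j => gamma s i j w) in
    (p%:E <= P [set w | approximates eps (num_ctables r c)%:R
                          (permanent_mean r c (A w))])%E)
  /\
  (forall eps : R, 0 < eps ->
   exists (prog : cmd) (q : {poly nat}),
   forall (m n N : nat) (r : 'I_m -> nat) (c : 'I_n -> nat),
     (forall i, (0 < r i <= rho)%N) -> (forall j, (0 < c j <= rho)%N) ->
     (\sum_i r i)%N = N -> (\sum_j c j)%N = N ->
     halts_within prog r c q.[N] /\
     p <= output_prob prog r c q.[N]
            [set x : R | approximates eps (num_ctables r c)%:R x]).
Proof.
split; last exact: ctables_randomized_approximation (ltW p_lt1).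
have [C [C_gt0 CP]] := permanent_mean_approximates rho_gt0 p_lt1.
exists C; split=> // eps eps_gt0 m n N r c r_le c_le _ _.
exact: CP.
Qed.
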